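(* The solution path of the Minimum-Time Intercept Problem (MTIP) lies in a sufficient family of 4 types, namely its type belongs to $\{RL,\,LR,\,LS,\,RS\}$.
   Context: Pursuer (Dubins vehicle): the state is $\boldsymbol z=(x,y,\theta)\in\mathbb{R}^2\times\mathbb{S}^1$ with dynamics $\dot x=\cos\theta$, $\dot y=\sin\theta$, $\dot\theta=u/\rho$, where $u(\cdot)$ is a measurable control with values in $[-1,1]$ and $\rho>0$ is the minimum turning radius. The initial configuration at $t=0$ is $\boldsymbol z_0=(0,0,\pi/2)$. Target: its velocity is $\boldsymbol v(t)=(v_x(t),v_y(t))$ (a given function of time), its initial position is $(\hat x_0,\hat y_0)$, and its position is $E(t)=(\hat x_0,\hat y_0)+\int_0^t\boldsymbol v(\tau)\,d\tau$ for $t\ge 0$. Standing assumption: $\|\boldsymbol v\|<1$ (Euclidean norm), so that the MTIP has a solution. MTIP: find the minimum time $t_m>0$ such that some measurable control $u(\cdot)$ on $[0,t_m]$ steers the pursuer from $\boldsymbol z_0$ at $t=0$ to intercept the target at $t_m$, i.e. $(x(t_m),y(t_m))=E(t_m)$ (final heading free). A solution path is the resulting curve $t\mapsto(x(t),y(t))$ on $[0,t_m]$. Path types: S is a straight line segment of length $d\ge0$; R (resp. L) is a circular arc of radius $\rho$ with right-turning (resp. left-turning) direction and radian $\alpha\ge0$. A word such as RL denotes the concatenation, in that order, of pieces of the indicated kinds along a path obeying the pursuer's dynamics. Pieces may have zero length, so substrings (R, L, S) are included. *)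

(* Defs.v *)
From HB Require Import structures.
From mathcomp Require Import all_boot all_order all_algebra.
From mathcomp Require Import all_classical all_reals all_analysis.

Set Implicit Arguments.
Unset Strict Implicit.
Unset Printing Implicit Defensive.

Import Order.TTheory GRing.Theory Num.Theory.
Import numFieldNormedType.Exports.

Local Open Scope classical_set_scope.
Local Open Scope ring_scope.

(* The library norm on [R * R] is the max norm, hence this definition. *)
Definition euclidean_norm (R : realType) (w : R * R) : R :=
  Num.sqrt (w.1 ^+ 2 + w.2 ^+ 2).

Definition admissible_control (R : realType) (T : R) (u : R -> R) : Prop :=
  measurable_fun `[0, T] u /\ forall t, 0 <= t <= T -> -1 <= u t <= 1.

(* Solutions of the Dubins dynamics are taken in the sense of Caratheodory,
   i.e. through the integral form of the equations, since the control is only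
   measurable.  The heading in the circle is represented by its continuous
   real-valued lift [theta] starting at pi / 2. *)
Definition dubins_trajectory (R : realType) (rho T : R) (u : R -> R)
    (gamma : R -> R * R) (theta : R -> R) : Prop :=
  forall t, 0 <= t <= T ->
  [/\ theta t = pi / 2 + \int[@lebesgue_measure R]_(s in `[0, t]) (u s / rho),
      (gamma t).1 = \int[@lebesgue_measure R]_(s in `[0, t]) cos (theta s)
    & (gamma t).2 = \int[@lebesgue_measure R]_(s in `[0, t]) sin (theta s)].

Definition target_position (R : realType) (p0 : R * R) (v : R -> R * R)
    (t : R) : R * R :=
  (p0.1 + \int[@lebesgue_measure R]_(s in `[0, t]) (v s).1,
   p0.2 + \int[@lebesgue_measure R]_(s in `[0, t]) (v s).2).

Definition intercepts (R : realType) (rho : R) (p0 : R * R) (v : R -> R * R)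
    (T : R) (gamma : R -> R * R) : Prop :=
  (exists u theta,
     admissible_control T u /\ dubins_trajectory rho T u gamma theta) /\
  gamma T = target_position p0 v T.

Definition mtip_solution (R : realType) (rho : R) (p0 : R * R)
    (v : R -> R * R) (tm : R) (gamma : R -> R * R) : Prop :=
  [/\ 0 < tm,
      intercepts rho p0 v tm gamma
    & forall T gamma', 0 < T -> intercepts rho p0 v T gamma' -> tm <= T].

Inductive piece : Set := SegS | ArcR | ArcL.

(* Curves are parametrized by arc length (the speed of the pursuer is 1), so a
   segment of length [d] occupies a time interval of length [d], and an arc of
   radian [alpha] one of length [rho * alpha].  An arc is described by its
   center [c] and the polar angle [beta] of its initial point around [c]; the
   polar angle decreases on a right turn and increases on a left turn. *)
Definition is_piece (R : realType) (rho : R) (gamma : R -> R * R) (a b : R)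
    (k : piece) : Prop :=
  match k with
  | SegS => exists d phi : R,
      [/\ 0 <= d, b = a + d
        & forall t, a <= t <= b ->
            gamma t = ((gamma a).1 + (t - a) * cos phi,
                       (gamma a).2 + (t - a) * sin phi)]
  | ArcR => exists (alpha : R) (c : R * R) (beta : R),
      [/\ 0 <= alpha, b = a + rho * alpha
        & forall t, a <= t <= b ->
            gamma t = (c.1 + rho * cos (beta - (t - a) / rho),
                       c.2 + rho * sin (beta - (t - a) / rho))]
  | ArcL => exists (alpha : R) (c : R * R) (beta : R),
      [/\ 0 <= alpha, b = a + rho * alpha
        & forall t, a <= t <= b ->
            gamma t = (c.1 + rho * cos (beta + (t - a) / rho),
                       c.2 + rho * sin (beta + (t - a) / rho))]
  end.

(* Tangency at the junctions is not part of this predicate: it is automatic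
   when [gamma] is a [dubins_trajectory], which is of class C^1. *)
Fixpoint has_type (R : realType) (rho : R) (gamma : R -> R * R) (a b : R)
    (w : seq piece) : Prop :=
  if w is k :: w' then
    exists c, is_piece rho gamma a c k /\ has_type rho gamma c b w'
  else a = b.

(* Main.v *)
(* Endpoints are integrals of [e ^ (i theta)], where the heading [theta] is an
   integral of the control.  If no direction [phi] makes the control [u] satisfy
   the first-order condition of the maximum principle, then every point near the
   end point of [u] is reached at every time close to the final one, by a
   convergent iteration of corrections [u + e (w - u)]; since the target moves
   continuously, it could then be intercepted earlier.  So every control
   reaching the interception point at the optimal time is extremal: with [Y] the
   signed distance to a line through the end point, it turns at full rate in the
   direction given by the sign of [Y].

   Conservation of the Hamiltonian shows that an extremal is an initial arc
   followed by full arcs of equal length between zeros of [Y] and by segments on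
   the line.  Unless it is of one of the four types, it ends with two full arcs,
   or with a full circle adjacent to a segment.  In both cases there is another
   trajectory with the same end point and duration, containing an arc of
   intermediate curvature; it is not extremal, a contradiction. *)

Require Import Defs.
From HB Require Import structures.
From mathcomp Require Import all_boot all_order all_algebra.
From mathcomp Require Import all_classical all_reals all_analysis.
From mathcomp Require Import measurable_realfun ring lra.

Set Implicit Arguments.
Unset Strict Implicit.
Unset Printing Implicit Defensive.

Import Order.TTheory GRing.Theory Num.Theory.
Import numFieldNormedType.Exports.

Local Open Scope classical_set_scope.
Local Open Scope ring_scope.

(** Controls and target velocity are only measurable, so nothing is differentiated along a
    trajectory: identities that calculus would draw from a vanishing derivative come from a bound
    [|f t - f s| <= C (t - s)^2], by subdivision. The same criterion copes with zeros of [Y] that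
    might accumulate. No decomposition into finitely many arcs is assumed: the pattern is read
    backwards from the end, two pieces deep at most.

    The iteration converges because each correction is proportional to the remaining miss. The gain
    must be uniform in [phi], which compactness provides, and stable near [u], which leaves room for
    ending slightly earlier.

    Extremality of one control does not exclude two full arcs; the way out is that it holds for
    every control with the same end point and duration. Two full arcs cover the same headings twice,
    so a single sweep at half rate replaces them. A full circle next to a segment has no such double
    sweep: the heading is then made to swing by [m] to both sides of the direction of the segment,
    and the circle is shortened by [3 m], an angle for which the triple-angle formulas make the two
    closing equations solvable. *)

Section SegmentIntegral.
Context {R : realType}.
Implicit Types (f g : R -> R) (a b c x M : R).

(** A class closed under sums and products that contains the controls and the continuous functions,
    and whose members are integrable on every segment: it settles all integrability side
    conditions. *)
Definition locally_bounded_measurable f :=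
  measurable_fun setT f /\
  forall a b, exists M, forall x, a <= x <= b -> `|f x| <= M.

Local Notation lbm := locally_bounded_measurable.

(** Not an oriented integral: the value is 0 when [b < a]. *)
Definition segint f a b := \int[@lebesgue_measure R]_(x in `[a, b]) f x.

Lemma lbm_bounded f M :
  measurable_fun setT f -> (forall x, `|f x| <= M) -> lbm f.
Proof. by move=> mf fM; split=> // a b; exists M. Qed.

Lemma lbm_continuous f : continuous f -> lbm f.
Proof.
move=> cf; split; first exact: continuous_measurable_fun.
move=> a b; have [ab|ba] := leP a b; last first.
  by exists 0 => x /andP[ax xb]; have := le_lt_trans (le_trans ax xb) ba;
    rewrite ltxx.
have /(EVT_max ab)[c _ fc] : {within `[a, b], continuous (fun x => `|f x|)}.
  apply: continuous_subspaceT => x; exact: (continuous_comp (cf x) (@norm_continuous _ _ _)).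
by exists `|f c| => x abx; apply: fc; rewrite in_itv.
Qed.

Lemma lbmD f g : lbm f -> lbm g -> lbm (fun x => f x + g x).
Proof.
move=> [mf bf] [mg bg]; split; first exact: measurable_funD.
move=> a b; have [M fM] := bf a b; have [N gN] := bg a b.
exists (M + N) => x abx; apply: (le_trans (ler_normD _ _)).
by rewrite lerD ?fM ?gN.
Qed.

Lemma lbmM f g : lbm f -> lbm g -> lbm (fun x => f x * g x).
Proof.
move=> [mf bf] [mg bg]; split; first exact: measurable_funM.
move=> a b; have [M fM] := bf a b; have [N gN] := bg a b.
by exists (M * N) => x abx; rewrite normrM ler_pM ?fM ?gN.
Qed.

Lemma lbm_cst c : lbm (fun=> c).
Proof. by apply: (@lbm_bounded _ `|c|). Qed.

Lemma lbmZ c f : lbm f -> lbm (fun x => c * f x).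
Proof. by move=> lf; apply: lbmM => //; exact: lbm_cst. Qed.

Lemma lbmB f g : lbm f -> lbm g -> lbm (fun x => f x - g x).
Proof.
move=> lf lg; have := lbmD lf (lbmZ (-1) lg).
by under [X in lbm X -> _]eq_fun do rewrite mulN1r.
Qed.

Lemma lbm_integrable f a b :
  lbm f -> (@lebesgue_measure R).-integrable `[a, b] (EFin \o f).
Proof.
move=> [mf bf]; apply: measurable_bounded_integrable => //=.
- by rewrite lebesgue_measure_itv/=; case: ifPn => // _; rewrite -EFinB ltry.
- exact: measurable_funTS.
- have [M fM] := bf a b; exists M; split; first exact: num_real.
  by move=> N MN x /=; rewrite in_itv/= => /fM fxM; exact: (le_trans fxM (ltW MN)).
Qed.

Lemma segint_eq f g a b :
  (forall x, a <= x <= b -> f x = g x) -> segint f a b = segint g a b.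
Proof.
by move=> fg; apply: eq_Rintegral => x; rewrite inE/= in_itv/= => /fg.
Qed.

Lemma segintD f g a b : lbm f -> lbm g ->
  segint (fun x => f x + g x) a b = segint f a b + segint g a b.
Proof. by move=> lf lg; rewrite /segint RintegralD//; exact: lbm_integrable. Qed.

Lemma segintB f g a b : lbm f -> lbm g ->
  segint (fun x => f x - g x) a b = segint f a b - segint g a b.
Proof. by move=> lf lg; rewrite /segint RintegralB//; exact: lbm_integrable. Qed.

Lemma segintZ c f a b : lbm f ->
  segint (fun x => c * f x) a b = c * segint f a b.
Proof. by move=> lf; rewrite /segint RintegralZl//; exact: lbm_integrable. Qed.

Lemma segint_cst c a b : a <= b -> segint (fun=> c) a b = c * (b - a).
Proof.
move=> ab; rewrite /segint Rintegral_cst//= lebesgue_measure_itv/= lte_fin.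
move: ab; rewrite le_eqVlt => /orP[/eqP->|ab]; first by rewrite ltxx subrr.
by rewrite ab -EFinB.
Qed.

Lemma segintxx f a : segint f a a = 0.
Proof. by rewrite /segint set_itv1 Rintegral_set1. Qed.

Lemma le_segint f g a b : lbm f -> lbm g ->
  (forall x, a <= x <= b -> f x <= g x) -> segint f a b <= segint g a b.
Proof.
by move=> lf lg fg; apply: le_Rintegral => //; exact: lbm_integrable.
Qed.

Lemma segint_cat f a b c : lbm f -> a <= b -> b <= c ->
  segint f a c = segint f a b + segint f b c.
Proof.
move=> lf ab bc; rewrite /segint.
have H := @Rintegral_itvB R f (BLeft a) (BRight c) b (lbm_integrable _ _ lf).
rewrite -[X in _ + X](Rintegral_itv_obnd_cbnd (r := b)).
  by rewrite -H ?bnd_simp// addrC subrK.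
apply: integrableS (lbm_integrable b c lf) => //.
by apply: subset_itvr; rewrite bnd_simp.
Qed.

Lemma normr_segint_le f a b M : lbm f -> a <= b ->
  (forall x, a <= x <= b -> `|f x| <= M) -> `|segint f a b| <= M * (b - a).
Proof.
move=> lf ab fM; rewrite ler_norml -mulNr.
rewrite -(segint_cst (- M) ab) -(segint_cst M ab).
by apply/andP; split; apply: le_segint => //; try exact: lbm_cst;
  move=> x /fM; rewrite ler_norml => /andP[].
Qed.

End SegmentIntegral.

(** * Quadratic increments, trigonometric estimates, polar coordinates *)

Section RealLemmas.
Context {R : realType}.
Implicit Types (f : R -> R) (a b x y h : R).

(** Cutting [[a, b]] into [n + 1] equal steps bounds the total increment by [C (b - a)^2 / (n + 1)].
    This takes the place of the vanishing-derivative argument for functions that are only Lipschitz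
    or given by integrals. *)
Lemma eq_of_quadratic_increments f a b C : a <= b ->
  (forall s t, a <= s -> s <= t -> t <= b ->
     `|f t - f s| <= C * (t - s) ^+ 2) -> f a = f b.
Proof.
move=> ab fC; apply/eqP; rewrite eq_sym -subr_eq0 -normr_le0.
have bound n : `|f b - f a| <= C * (b - a) ^+ 2 / n.+1%:R.
  have n0 : 0 < n.+1%:R :> R by rewrite ltr0n.
  set h := (b - a) / n.+1%:R.
  have h0 : 0 <= h by rewrite divr_ge0 ?subr_ge0// ltW.
  have hb : n.+1%:R * h = b - a by rewrite mulrC divfK// gt_eqF.
  have step k : (k <= n.+1)%N ->
      `|f (a + k%:R * h) - f a| <= k%:R * (C * h ^+ 2).
    elim: k => [|k IH] kn; first by rewrite !mul0r addr0 subrr normr0.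
    have kh : a + k.+1%:R * h <= b.
      by rewrite -lerBrDl -hb ler_wpM2r// ler_nat.
    rewrite -(subrKA (f (a + k%:R * h))) addrC.
    apply: (le_trans (ler_normD _ _)).
    have := fC (a + k%:R * h) (a + k.+1%:R * h).
    rewrite lerDl mulr_ge0// => /(_ isT).
    rewrite lerD2l ler_wpM2r ?ler_nat// => /(_ isT kh).
    have := IH (ltnW kn).
    rewrite -natr1 (_ : a + (k%:R + 1) * h - (a + k%:R * h) = h); last by ring.
    by move=> A B; rewrite [leRHS]mulrDl mul1r lerD.
  have := step n.+1 (leqnn _).
  rewrite hb [a + _]addrC subrK => /le_trans; apply.
  rewrite /h exprMn (_ : n.+1%:R * _ = C * (b - a) ^+ 2 / n.+1%:R)//.
  by field; rewrite gt_eqF.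
apply/ler_addgt0Pl => e e0; rewrite addr0.
set K := C * (b - a) ^+ 2 in bound.
have [N] : exists N, K / e < N.+1%:R.
  by exists (Num.truncn (K / e)); exact: truncnS_gt.
move=> KN; apply: (le_trans (bound N)).
by rewrite ler_pdivrMr ?ltr0n// -ler_pdivrMl// mulrC ltW.
Qed.

Lemma normr_sin_le x : `|sin x| <= `|x|.
Proof.
wlog x0 : x / 0 <= x => [H|].
  have [/H//|/ltW] := leP 0 x; rewrite -oppr_ge0 => /H.
  by rewrite sinN !normrN.
have [c _] := @MVT_segment R sin cos 0 x x0 (fun y _ => is_derive_sin y)
  (continuous_subspaceT (@continuous_sin R)).
rewrite sin0 !subr0 => ->; rewrite normrM ler_piMl// cos_max//.
Qed.

Lemma cosB_sin x y :
  cos x - cos y = - 2 * sin ((x + y) / 2) * sin ((x - y) / 2).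
Proof.
have -> : cos x = cos ((x + y) / 2 + (x - y) / 2) by congr cos; field.
have -> : cos y = cos ((x + y) / 2 - (x - y) / 2) by congr cos; field.
by rewrite cosD cosB; ring.
Qed.

Lemma cos_lipschitz x y : `|cos x - cos y| <= `|x - y|.
Proof.
rewrite cosB_sin !normrM normrN (ger0_norm (ler0n _ _)).
apply: (@le_trans _ _ (2 * 1 * `|(x - y) / 2|)).
  by rewrite ler_pM ?mulr_ge0 ?normr_sin_le ?ler_wpM2l ?sin_max.
by rewrite mulr1 normrM [X in _ * (_ * X)]ger0_norm ?invr_ge0// mulrCA divff ?mulr1.
Qed.

Lemma sin_lipschitz x y : `|sin x - sin y| <= `|x - y|.
Proof.
rewrite -!cosBpihalf; apply: (le_trans (cos_lipschitz _ _)).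
by rewrite opprB addrA subrK.
Qed.

Lemma cos_taylor1 x h : `|cos (x + h) - cos x + h * sin x| <= 2 * h ^+ 2.
Proof.
have c1 : `|cos h - 1| <= h ^+ 2 / 2.
  rewrite (_ : cos h - 1 = cos h - cos 0); last by rewrite cos0.
  rewrite cosB_sin addr0 subr0 !normrM normrN (ger0_norm (ler0n _ _)).
  have := normr_sin_le (h / 2); rewrite -mulrA => H.
  apply: (@le_trans _ _ (2 * (`|h / 2| * `|h / 2|))).
    by rewrite ler_wpM2l// ler_pM.
  by rewrite -expr2 real_normK ?num_real// le_eqVlt; apply/orP; left; apply/eqP; field.
have s1 : `|sin h - h| <= h ^+ 2.
  wlog h0 : h c1 / 0 <= h => [H|].
    have [/H|/ltW] := leP 0 h; first exact.
    rewrite -oppr_ge0 => /H; rewrite cosN sqrrN sinN -opprD normrN; exact.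
  have [c] := @MVT_segment R sin cos 0 h h0 (fun y _ => is_derive_sin y)
    (continuous_subspaceT (@continuous_sin R)).
  rewrite sin0 !subr0 in_itv/= => /andP[c0 ch] ->.
  rewrite -[X in _ - X]mul1r -mulrBl normrM (ger0_norm h0) expr2 ler_wpM2r//.
  rewrite (_ : cos c - 1 = cos c - cos 0); last by rewrite cos0.
  apply: (le_trans (cos_lipschitz _ _)).
  by rewrite subr0 ger0_norm.
rewrite (_ : cos (x + h) - cos x + h * sin x =
  cos x * (cos h - 1) - sin x * (sin h - h)); last first.
  by rewrite cosD; ring.
apply: (le_trans (ler_normB _ _)).
rewrite !normrM.
have -> : 2 * h ^+ 2 = 1 * h ^+ 2 + 1 * h ^+ 2 by ring.
apply: lerD; apply: ler_pM => //; try exact: cos_max; try exact: sin_max.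
by apply: (le_trans c1); have := sqr_ge0 h; lra.
Qed.

(** The angle is kept in a compact interval, over which a gain can be made uniform. *)
Lemma polar (q1 q2 : R) : exists phi, [/\ - pi <= phi <= pi,
  q1 = Num.sqrt (q1 ^+ 2 + q2 ^+ 2) * cos phi &
  q2 = Num.sqrt (q1 ^+ 2 + q2 ^+ 2) * sin phi].
Proof.
have qq0 : 0 <= q1 ^+ 2 + q2 ^+ 2 by rewrite addr_ge0 ?sqr_ge0.
set N := Num.sqrt _.
have N2 : N ^+ 2 = q1 ^+ 2 + q2 ^+ 2 by rewrite sqr_sqrtr.
have N0 : 0 <= N by exact: sqrtr_ge0.
have [NE|NE] := eqVneq N 0.
  move: N2; rewrite NE expr0n/= => /esym/eqP.
  rewrite paddr_eq0 ?sqr_ge0// !sqrf_eq0 => /andP[/eqP-> /eqP->].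
  by exists 0; rewrite !mul0r oppr_le0 pi_ge0.
have Npos : 0 < N by rewrite lt_neqAle eq_sym NE.
have q2N : 1 - (q1 / N) ^+ 2 = (q2 / N) ^+ 2.
  by rewrite !expr_div_n N2; field; rewrite -N2 expf_neq0.
have x1 : -1 <= q1 / N <= 1.
  rewrite -ler_norml -(@expr_le1 _ 2)// real_normK ?num_real//.
  by rewrite -subr_ge0 q2N sqr_ge0.
have cq : q1 = N * cos (acos (q1 / N)) by rewrite acosK// mulrC divfK.
have sq : `|q2| = N * sin (acos (q1 / N)).
  rewrite sin_acos// q2N sqrtr_sqr normrM normfV (gtr0_norm Npos).
  by rewrite mulrC divfK.
have a0 := acos_ge0 x1; have ap := acos_lepi x1.
have p0 := @pi_ge0 R.
have [q20|q20] := leP 0 q2.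
  exists (acos (q1 / N)); split=> //; last by rewrite -sq ger0_norm.
  by rewrite ap andbT (le_trans _ a0)// oppr_le0.
exists (- acos (q1 / N)); rewrite cosN sinN mulrN -sq ltr0_norm// opprK.
by split=> //; rewrite lerN2 ap (le_trans _ p0)// oppr_le0.
Qed.

End RealLemmas.

(** * Heading and position as functions of the control *)

Section Heading.
Context {R : realType} (rho : R) (rho_gt0 : 0 < rho).
Implicit Types (u w : R -> R) (s t phi e : R).

(** Taken on the whole line, so that controls can be mixed, overwritten and used for different
    durations without domain conditions. *)
Definition control u := measurable_fun setT u /\ forall t, `|u t| <= 1.

Definition heading u t := pi / 2 + segint (fun s => u s / rho) 0 t.

(* The coordinate of the position in direction [phi]: the abscissa for [phi = 0],
   the ordinate for [phi = pi / 2]. *)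
Definition advance u phi t := segint (fun s => cos (heading u s - phi)) 0 t.

Lemma control_lbm u : control u -> locally_bounded_measurable u.
Proof. by move=> [mu u1]; exact: (@lbm_bounded _ _ 1). Qed.

Lemma control_rate_lbm u : control u ->
  locally_bounded_measurable (fun s => u s / rho).
Proof. by move=> /control_lbm lu; apply: lbmM => //; exact: lbm_cst. Qed.

(** The integral over an empty interval is 0; this default makes the heading Lipschitz, hence
    continuous, on the whole line. *)
Lemma heading_lt0 u t : t < 0 -> heading u t = pi / 2.
Proof.
move=> t0; rewrite /heading /segint set_itv_ge ?bnd_simp -?ltNge//.
by rewrite Rintegral_set0 addr0.
Qed.

Lemma heading_cat u s t : control u -> 0 <= s -> s <= t ->
  heading u t = heading u s + segint (fun r => u r / rho) s t.
Proof.
move=> cu s0 st; rewrite /heading (segint_cat _ s0 st) ?addrA//.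
exact: control_rate_lbm.
Qed.

Lemma normr_rate_le u : control u -> forall t, `|u t / rho| <= 1 / rho.
Proof.
move=> [_ u1] t; rewrite normrM [X in _ * X]gtr0_norm ?invr_gt0//.
by rewrite ler_wpM2r// invr_ge0 ltW.
Qed.

Lemma heading_lipschitz u s t : control u ->
  `|heading u t - heading u s| <= `|t - s| / rho.
Proof.
move=> cu; wlog st : s t / s <= t => [H|].
  have [/H//|/ltW/H] := leP s t.
  by rewrite distrC [X in _ <= X / _ -> _]distrC.
have [s0|s0] := leP 0 s.
  rewrite (heading_cat cu s0 st) addrC addKr [`|t - s|]ger0_norm ?subr_ge0//.
  have := normr_segint_le (control_rate_lbm cu) st (fun x _ => normr_rate_le cu x).
  by rewrite mul1r mulrC.
have [t0|t0] := leP 0 t; last first.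
  by rewrite !heading_lt0// subrr normr0 divr_ge0// ltW.
rewrite (heading_lt0 u s0) /heading addrC addKr.
apply: (@le_trans _ _ (1 / rho * (t - 0))).
  apply: normr_segint_le => //; first exact: control_rate_lbm.
  by move=> x _; exact: normr_rate_le.
rewrite mul1r mulrC ler_wpM2r ?invr_ge0 ?(ltW rho_gt0)//.
by rewrite ger0_norm ?subr_ge0//; lra.
Qed.

Lemma lipschitz_continuous (f : R -> R) (k : R) : 0 < k ->
  (forall s t, `|f t - f s| <= `|t - s| * k) -> continuous f.
Proof.
move=> k0 fk s; apply/cvgrPdist_lt => e e0; near=> t.
rewrite distrC; apply: (le_lt_trans (fk s t)); rewrite -ltr_pdivlMr// distrC.
near: t; exists (e / k) => //=; exact: divr_gt0.
Unshelve. all: by end_near. Qed.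

Lemma continuous_heading u : control u -> continuous (heading u).
Proof.
move=> cu; apply: (@lipschitz_continuous _ rho^-1); rewrite ?invr_gt0//.
by move=> s t; exact: heading_lipschitz.
Qed.

Lemma continuous_cos_heading u phi : control u ->
  continuous (fun s => cos (heading u s - phi)).
Proof.
move=> cu s; apply: continuous_comp; last exact: continuous_cos.
by apply: continuousB; [exact: continuous_heading|exact: cst_continuous].
Qed.

Lemma continuous_sin_heading u phi : control u ->
  continuous (fun s => sin (phi - heading u s)).
Proof.
move=> cu s; apply: continuous_comp; last exact: continuous_sin.
by apply: continuousB; [exact: cst_continuous|exact: continuous_heading].
Qed.

Lemma lbm_cos_heading u phi : control u ->
  locally_bounded_measurable (fun s => cos (heading u s - phi)).
Proof. by move=> cu; apply: lbm_continuous; exact: continuous_cos_heading. Qed.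

Lemma lbm_sin_heading u phi : control u ->
  locally_bounded_measurable (fun s => sin (phi - heading u s)).
Proof. by move=> cu; apply: lbm_continuous; exact: continuous_sin_heading. Qed.

Lemma heading_dist u w e t : control u -> control w -> 0 <= t ->
  (forall s, `|u s - w s| <= e) -> `|heading u t - heading w t| <= e / rho * t.
Proof.
move=> cu cw t0 uw; rewrite /heading opprD addrACA subrr add0r.
rewrite -segintB; [|exact: control_rate_lbm..].
rewrite -[X in _ * X]subr0; apply: normr_segint_le => //.
  by apply: lbmB; exact: control_rate_lbm.
move=> x _; rewrite -mulrBl normrM [X in _ * X]gtr0_norm ?invr_gt0//.
by rewrite ler_wpM2r// invr_ge0 ltW.
Qed.

Lemma heading_dist2 u w t T : control u -> control w -> 0 <= t <= T ->
  `|heading u t - heading w t| <= 2 / rho * T.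
Proof.
move=> cu cw /andP[t0 tT]; apply: (@le_trans _ _ (2 / rho * t)).
  apply: heading_dist => // s; apply: (le_trans (ler_normB _ _)).
  by rewrite (_ : 2 = 1 + 1 :> R) ?lerD ?(cu.2) ?(cw.2)//.
by rewrite ler_wpM2l// divr_ge0// ltW.
Qed.

Lemma advanceE u phi t : control u ->
  advance u phi t = cos phi * advance u 0 t + sin phi * advance u (pi / 2) t.
Proof.
move=> cu; rewrite /advance -!segintZ; try exact: lbm_cos_heading.
rewrite -segintD; try (apply: lbmZ; exact: lbm_cos_heading).
by apply: segint_eq => x _; rewrite subr0 cosBpihalf cosB mulrC [sin _ * _]mulrC.
Qed.

Lemma advance_dist u w e phi s T : control u -> control w -> 0 <= s <= T ->
  (forall t, `|u t - w t| <= e) ->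
  `|advance u phi s - advance w phi s| <= e / rho * T * T.
Proof.
move=> cu cw /andP[s0 sT] uw; rewrite /advance -segintB; try exact: lbm_cos_heading.
have e0 : 0 <= e by apply: le_trans (uw 0).
have T0 := le_trans s0 sT.
have K0 : 0 <= e / rho * T by rewrite mulr_ge0// divr_ge0// ltW.
apply: (@le_trans _ _ (e / rho * T * (s - 0))); last by rewrite subr0 ler_wpM2l.
apply: normr_segint_le => //; first by apply: lbmB; exact: lbm_cos_heading.
move=> x /andP[x0 xs]; apply: (le_trans (cos_lipschitz _ _)).
rewrite opprB addrA subrK; apply: (le_trans (heading_dist cu cw x0 uw)).
by rewrite ler_wpM2l ?(le_trans xs)// divr_ge0// ltW.
Qed.

End Heading.

(** * Openness of the end-point map at non-extremal controls *)

Section Openness.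
Context {R : realType} (rho : R) (rho_gt0 : 0 < rho).
Implicit Types (u w : R -> R) (s t phi e T : R).

Local Notation heading := (heading rho).
Local Notation advance := (advance rho).

(* The component in direction [phi] of the derivative of the end point at time
   [s] when the control [u] is moved towards [w]. *)
Definition gain phi w u s :=
  segint (fun t => (heading w t - heading u t) * sin (phi - heading u t)) 0 s.

Lemma lbm_heading u : control u -> locally_bounded_measurable (heading u).
Proof. by move=> cu; apply: lbm_continuous; exact: continuous_heading. Qed.

Lemma lbm_gain phi w u : control w -> control u -> locally_bounded_measurable
  (fun t => (heading w t - heading u t) * sin (phi - heading u t)).
Proof.
by move=> cw cu; apply: lbmM; [apply: lbmB; exact: lbm_heading|exact: lbm_sin_heading].
Qed.

Lemma control_convex u w e : control u -> control w -> 0 <= e <= 1 ->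
  control (fun t => u t + e * (w t - u t)).
Proof.
move=> [mu u1] [mw w1] /andP[e0 e1]; split.
  by apply: measurable_funD => //; apply: measurable_funM => //; exact: measurable_funB.
move=> t; rewrite (_ : _ + _ = (1 - e) * u t + e * w t); last by ring.
apply: (le_trans (ler_normD _ _)); rewrite !normrM.
rewrite (ger0_norm e0) ger0_norm ?subr_ge0//.
rewrite -[leRHS](subrK e) lerD//.
  by rewrite ler_piMr ?subr_ge0.
by rewrite ler_piMr.
Qed.

Lemma heading_convex u w e t : control u -> control w ->
  heading (fun t => u t + e * (w t - u t)) t =
  heading u t + e * (heading w t - heading u t).
Proof.
move=> cu cw; rewrite /heading.
set A := segint (fun s => u s / rho) 0 t.
set B := segint (fun s => w s / rho) 0 t.
rewrite (_ : pi / 2 + B - (pi / 2 + A) = B - A); last by ring.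
rewrite -addrA; congr (_ + _).
rewrite /A /B -segintB; [|exact: control_rate_lbm..].
rewrite -segintZ; last by apply: lbmB; exact: control_rate_lbm.
rewrite -segintD; last 2 first.
- exact: control_rate_lbm.
- by apply: lbmZ; apply: lbmB; exact: control_rate_lbm.
by apply: segint_eq => x _; ring.
Qed.

(** The heading is affine in [e], so [cos_taylor1], applied at each time and integrated, controls
    the error of the first-order expansion; [2 / rho * T] bounds the difference of two headings on
    [[0, T]]. *)
Lemma advance_convex_ge u w e phi s T : control u -> control w -> 0 <= e <= 1 ->
  0 <= s <= T ->
  advance u phi s + e * gain phi w u s - 2 * e ^+ 2 * (2 / rho * T) ^+ 2 * T
    <= advance (fun t => u t + e * (w t - u t)) phi s.
Proof.
move=> cu cw e01 /andP[s0 sT].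
have cv := control_convex cu cw e01.
have T0 := le_trans s0 sT.
set M := 2 / rho * T; rewrite lerBlDr -lerBlDl /advance /gain.
set v := fun t : R => u t + e * (w t - u t).
rewrite -segintZ; last exact: lbm_gain.
rewrite -segintD; [|exact: lbm_cos_heading|by apply: lbmZ; exact: lbm_gain].
rewrite -segintB; last 2 first.
- by apply: lbmD; [exact: lbm_cos_heading|apply: lbmZ; exact: lbm_gain].
- exact: lbm_cos_heading.
apply: (@le_trans _ _ (2 * e ^+ 2 * M ^+ 2 * (s - 0))); last first.
  rewrite subr0 ler_wpM2l//; apply: mulr_ge0; last exact: sqr_ge0.
  by apply: mulr_ge0 => //; exact: sqr_ge0.
rewrite -segint_cst//; apply: le_segint.
- apply: lbmB; last exact: lbm_cos_heading.
  by apply: lbmD; [exact: lbm_cos_heading|apply: lbmZ; exact: lbm_gain].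
- exact: lbm_cst.
move=> x /andP[x0 xs]; rewrite heading_convex//.
have x0T : 0 <= x <= T by rewrite x0 (le_trans xs).
have := heading_dist2 rho_gt0 cw cu x0T; rewrite -/M.
set D := heading w x - heading u x => DM.
have := cos_taylor1 (heading u x - phi) (e * D).
rewrite -[_ - phi + _]addrAC ler_norml => /andP[H _].
rewrite -[phi - _]opprB sinN.
have : 2 * (e * D) ^+ 2 <= 2 * e ^+ 2 * M ^+ 2.
  rewrite exprMn -mulrA ler_wpM2l// ler_wpM2l ?sqr_ge0//.
  by rewrite -(real_normK (num_real D)) ler_pXn2r ?nnegrE// (le_trans _ DM).
by lra.
Qed.

(** The first loss comes from moving the control, which changes the heading both in the difference
    of headings and inside the sine; the second is the part of the integral beyond [s]. *)
Lemma gain_near u0 u w phi r s T : control u0 -> control u -> control w ->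
  0 <= s <= T -> (forall t, `|u t - u0 t| <= r) ->
  gain phi w u0 T - (1 + 2 / rho * T) * (r / rho * T) * T - 2 / rho * T * (T - s)
    <= gain phi w u s.
Proof.
move=> cu0 cu cw /andP[s0 sT] ur.
have T0 := le_trans s0 sT.
have r0 : 0 <= r by apply: le_trans (ur 0).
have ir0 : 0 <= 1 / rho by rewrite divr_ge0// ltW.
set M := 2 / rho * T.
have M0 : 0 <= M by rewrite mulr_ge0// divr_ge0// ltW.
set d := r / rho * T.
have d0 : 0 <= d by rewrite mulr_ge0// divr_ge0// ltW.
rewrite /gain (segint_cat _ s0 sT); last exact: lbm_gain.
set G := fun t => (heading w t - heading u0 t) * sin (phi - heading u0 t).
have tail : segint G s T <= M * (T - s).
  apply: (le_trans (ler_norm _)); apply: normr_segint_le => //.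
    exact: lbm_gain.
  move=> x /andP[sx xT]; rewrite normrM -[leRHS]mulr1.
  apply: ler_pM => //; last exact: sin_max.
  by apply: heading_dist2 => //; rewrite xT (le_trans s0).
have front : segint G 0 s - segint (fun t => (heading w t - heading u t) *
    sin (phi - heading u t)) 0 s <= (1 + M) * d * T.
  rewrite -segintB; [|exact: lbm_gain..].
  apply: (@le_trans _ _ ((1 + M) * d * (s - 0))); last first.
    by rewrite subr0 ler_wpM2l// mulr_ge0// addr_ge0.
  apply: (le_trans (ler_norm _)); apply: normr_segint_le => //.
    by apply: lbmB; exact: lbm_gain.
  move=> x /andP[x0 xs]; rewrite /G.
  have xT : 0 <= x <= T by rewrite x0 (le_trans xs).
  have A : `|heading u x - heading u0 x| <= d.
    apply: (le_trans (heading_dist rho_gt0 cu cu0 x0 ur)).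
    by rewrite ler_wpM2l ?(le_trans xs)// divr_ge0// ltW.
  have B := heading_dist2 rho_gt0 cw cu0 xT.
  have C : `|sin (phi - heading u0 x) - sin (phi - heading u x)| <= d.
    apply: (le_trans (sin_lipschitz _ _)); apply: le_trans A.
    by rewrite le_eqVlt; apply/orP; left; apply/eqP; congr `| _ |; ring.
  rewrite (_ : _ - _ =
    (heading w x - heading u0 x) *
      (sin (phi - heading u0 x) - sin (phi - heading u x)) +
    (heading u x - heading u0 x) * sin (phi - heading u x)); last by ring.
  apply: (le_trans (ler_normD _ _)); rewrite !normrM mulrDl addrC.
  apply: lerD; last exact: ler_pM.
  by rewrite [leRHS]mulrC ler_pM// sin_max.
move: tail front; move: (M * (T - s)) ((1 + M) * d * T) => X Y.
move: (segint G 0 s) (segint G s T) (segint _ _ _) => P Q S.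
by lra.
Qed.

Definition miss (E : R * R) u s : R := Num.sqrt
  ((E.1 - advance u 0 s) ^+ 2 + (E.2 - advance u (pi / 2) s) ^+ 2).

(** Here [N] is the miss, [(C, S)] its direction and [(d1, d2)] the displacement caused by a
    correction of size [c * N]. In the expanded square, the condition on [c] lets the second-order
    errors consume at most half of the progress [2 c eta N^2], and
    [1 - c eta <= (1 - c eta / 2)^2]. *)
Lemma correction_arith (q1 q2 C S N c eta M T d1 d2 G : R) :
  q1 = N * C -> q2 = N * S -> N ^+ 2 = q1 ^+ 2 + q2 ^+ 2 ->
  0 <= N -> N <= 1 -> 0 <= c -> 0 <= T -> eta <= G ->
  c * N * G - 2 * (c * N) ^+ 2 * M ^+ 2 * T <= C * d1 + S * d2 ->
  c * (4 * M ^+ 2 * T + 2 * (M * T) ^+ 2) <= eta ->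
  d1 ^+ 2 <= (c * N * M * T) ^+ 2 -> d2 ^+ 2 <= (c * N * M * T) ^+ 2 ->
  (q1 - d1) ^+ 2 + (q2 - d2) ^+ 2 <= ((1 - c * eta / 2) * N) ^+ 2.
Proof.
move=> q1E q2E N2 N0 N1 c0 T0 etaG fo cK d1M d2M.
set A := C * d1 + S * d2 in fo.
have -> : (q1 - d1) ^+ 2 + (q2 - d2) ^+ 2 = N ^+ 2 - 2 * N * A + (d1 ^+ 2 + d2 ^+ 2).
  by rewrite N2 /A q1E q2E; ring.
clearbody A; have NN := mulr_ge0 N0 N0; have cN := mulr_ge0 c0 N0.
have H1 : c * N * eta <= c * N * G by rewrite ler_wpM2l.
have H2 : 2 * N * (c * N * eta - 2 * (c * N) ^+ 2 * M ^+ 2 * T) <= 2 * N * A.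
  by apply: ler_wpM2l; [exact: mulr_ge0|lra].
have H3 : N * (4 * (c * N) ^+ 2 * M ^+ 2 * T) <= 4 * (c * N) ^+ 2 * M ^+ 2 * T.
  apply: ler_piMl => //; apply: mulr_ge0 => //; apply: mulr_ge0; last exact: sqr_ge0.
  by apply: mulr_ge0 => //; exact: sqr_ge0.
have H4 : c * N ^+ 2 * (c * (4 * M ^+ 2 * T + 2 * (M * T) ^+ 2)) <= c * N ^+ 2 * eta.
  by apply: ler_wpM2l => //; apply: mulr_ge0 => //; exact: sqr_ge0.
have := sqr_ge0 (c * eta / 2 * N).
clear - H2 H3 H4 d1M d2M.
lra.
Qed.

Lemma correction_step u s T E eta c : control u -> 0 <= s <= T ->
  0 <= c -> c <= 1 -> c * eta <= 1 ->
  c * (4 * (2 / rho * T) ^+ 2 * T + 2 * (2 / rho * T * T) ^+ 2) <= eta ->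
  miss E u s <= 1 ->
  (forall phi, - pi <= phi <= pi ->
     exists2 w, control w & eta <= gain phi w u s) ->
  exists u', [/\ control u', forall t, `|u' t - u t| <= 2 * c * miss E u s &
    miss E u' s <= (1 - c * eta / 2) * miss E u s].
Proof.
move=> cu s0T c0 c1 ceta cK mu1 uw.
have T0 : 0 <= T by move: s0T => /andP[]; exact: le_trans.
have [phi [phipi]] := polar (E.1 - advance u 0 s) (E.2 - advance u (pi / 2) s).
have := sqr_sqrtr (addr_ge0 (sqr_ge0 (E.1 - advance u 0 s))
  (sqr_ge0 (E.2 - advance u (pi / 2) s))).
have := sqrtr_ge0 ((E.1 - advance u 0 s) ^+ 2 + (E.2 - advance u (pi / 2) s) ^+ 2).
rewrite -/(miss E u s) => N0 N2 q1E q2E; have [w cw gw] := uw _ phipi.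
move: (miss E u s) N0 N2 q1E q2E mu1 => N N0 N2 q1E q2E N1.
have e01 : 0 <= c * N <= 1 by rewrite mulr_ge0//= -[1]mulr1 ler_pM.
have /andP[e0 e1] := e01.
set u' := fun t => u t + c * N * (w t - u t).
have cu' : control u' by exact: control_convex.
have u'u t : `|u' t - u t| <= 2 * (c * N).
  rewrite /u' addrC addKr normrM (ger0_norm e0) mulrC ler_wpM2r//.
  apply: (le_trans (ler_normB _ _)).
  by rewrite (_ : 2 = 1 + 1 :> R) ?lerD ?(cu.2) ?(cw.2)//.
exists u'; split => //; first by move=> t; rewrite -mulrA.
have fo := advance_convex_ge phi cu cw e01 s0T; rewrite -/u' in fo.
have M0 : 0 <= 2 / rho * T by rewrite mulr_ge0// divr_ge0// ltW.
have D0 phi' : (advance u' phi' s - advance u phi' s) ^+ 2 <=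
    (c * N * (2 / rho * T) * T) ^+ 2.
  have := advance_dist rho_gt0 phi' cu' cu s0T u'u.
  rewrite (_ : 2 * (c * N) / rho * T * T = c * N * (2 / rho * T) * T); last by ring.
  move=> H; rewrite -(real_normK (num_real (_ - _))).
  apply: lerXn2r H; rewrite nnegrE//.
  by apply: mulr_ge0 => //; exact: mulr_ge0.
have k0 : 0 <= 1 - c * eta / 2 by clear - ceta; lra.
rewrite -(@ler_sqr _ (miss E u' s)); last 2 first.
- by rewrite nnegrE sqrtr_ge0.
- by rewrite nnegrE mulr_ge0.
rewrite sqr_sqrtr ?addr_ge0 ?sqr_ge0//.
rewrite (advanceE rho_gt0 phi s cu') (advanceE rho_gt0 phi s cu) in fo.
move: fo (D0 0) (D0 (pi / 2)) q1E q2E N2; clear -T0 c0 N0 N1 cK gw.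
move: (advance u' 0 s) (advance u' (pi / 2) s) (advance u 0 s) (advance u (pi / 2) s).
move=> x' y' x y fo D1 D2 q1E q2E N2.
have := @correction_arith (E.1 - x) (E.2 - y) (cos phi) (sin phi) N c eta
  (2 / rho * T) T (x' - x) (y' - y) (gain phi w u s) q1E q2E N2 N0 N1 c0 T0 gw.
move=> /(_ _ cK D1 D2).
rewrite (_ : E.1 - x - (x' - x) = E.1 - x'); last by ring.
rewrite (_ : E.2 - y - (y' - y) = E.2 - y'); last by ring.
apply; move: fo; clear; move: (gain _ _ _ _) (2 / rho * T) => G M; lra.
Qed.

(** Bounding each move by the drop of [m] makes the moves telescope: their total stays below
    [K * m u0 <= r], so every iterate remains in the ball where corrections exist. *)
Lemma iterated_correction (m : (R -> R) -> R) u0 r k K : control u0 ->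
  0 <= K -> 0 <= k < 1 -> (forall u, 0 <= m u) -> m u0 <= 1 -> K * m u0 <= r ->
  (forall u, control u -> (forall t, `|u t - u0 t| <= r) -> m u <= 1 ->
    exists u', [/\ control u', forall t, `|u' t - u t| <= K * (m u - m u') &
      m u' <= k * m u]) ->
  exists v, control v /\ forall n, exists u,
    [/\ control u, forall t, `|v t - u t| <= K * m u & m u <= k ^+ n].
Proof.
move=> cu0 K0 /andP[k0 k1] m0 mu0 mr correct.
pose Inv u := [/\ control u, m u <= 1 & forall t, `|u t - u0 t| + K * m u <= r].
have step (x : {u | Inv u}) : exists y : {u | Inv u},
    (forall t, `|sval y t - sval x t| <= K * (m (sval x) - m (sval y)))
    /\ m (sval y) <= k * m (sval x).
  case: x => u [cu mu1 ur]/=.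
  have ur' t : `|u t - u0 t| <= r.
    by apply: le_trans (ur t); rewrite lerDl mulr_ge0.
  have [u' [cu' u'u mu']] := correct u cu ur' mu1.
  have Iu' : Inv u'.
    split=> //; first by apply: (le_trans mu'); rewrite -[1]mulr1 ler_pM// ltW.
    move=> t; apply: le_trans (ur t).
    have := ler_distD (u t) (u' t) (u0 t); have := u'u t.
    by rewrite mulrBr; lra.
  by exists (exist _ u' Iu').
have [F FP] := choice step.
have I0 : Inv u0 by split=> // t; rewrite subrr normr0 add0r.
pose U n := sval (iter n F (exist _ u0 I0)).
pose N n := m (U n).
have IU n : Inv (U n) by exact: (svalP (iter n F _)).
have N0 n : 0 <= N n by exact: m0.
have US n t : `|U n.+1 t - U n t| <= K * (N n - N n.+1).
  exact: (FP (iter n F (exist _ u0 I0))).1.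
have NS n : N n.+1 <= k * N n by exact: (FP (iter n F (exist _ u0 I0))).2.
have Uk n j t : `|U (n + j)%N t - U n t| <= K * (N n - N (n + j)%N).
  elim: j => [|j IH]; first by rewrite addn0 !subrr normr0 mulr0.
  rewrite addnS; have := US (n + j)%N t; move: IH.
  have := ler_distD (U (n + j)%N t) (U (n + j).+1 t) (U n t).
  by rewrite !mulrBr; lra.
have Nk n : N n <= k ^+ n.
  elim: n => [|n IH]; first by rewrite expr0; have [] := I0.
  by rewrite exprS; apply: (le_trans (NS n)); rewrite ler_wpM2l.
have Ncvg : N @ \oo --> 0.
  apply: (@squeeze_cvgr _ _ _ _ (fun=> 0) (fun n => k ^+ n)).
  - by near=> n; rewrite N0 Nk.
  - exact: cvg_cst.
  - by apply: cvg_expr; rewrite ger0_norm.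
have Ucvg t : cvgn (fun n => U n t).
  (* [U n t + K * N n] is nonincreasing in [n] and bounded below by [-1], which gives pointwise
     convergence by monotonicity. *)
  have -> : (fun n => U n t) = (fun n => (U n t + K * N n) - K * N n).
    by apply/funext => n; rewrite addrK.
  apply: is_cvgB; last by apply: is_cvgMr; apply/cvg_ex; exists 0.
  apply: nonincreasing_is_cvgn.
    apply/nonincreasing_seqP => n; have := US n t.
    by rewrite ler_norml mulrBr => /andP[_]; lra.
  exists (-1) => _ [n _ <-]; have [[_ /(_ t) + _ _]] := IU n.
  rewrite ler_norml => /andP[+ _] => /le_trans; apply.
  by rewrite lerDl mulr_ge0.
pose v t := limn (fun n => U n t).
have vU n t : `|v t - U n t| <= K * N n.
  apply/ler_addgt0Pl => e e0.
  have /cvgrPdist_lt/(_ e e0)[j _ jP] := Ucvg t.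
  have := jP (n + j)%N (leq_addl _ _) => /=.
  have := Uk n j t; rewrite mulrBr.
  have := mulr_ge0 K0 (N0 (n + j)%N).
  have := ler_distD (U (n + j)%N t) (v t) (U n t); rewrite /v; lra.
exists v; split; last first.
  move=> n; have [cU _ _] := IU n; exists (U n).
  by split; [exact: cU|exact: vU|exact: Nk].
split.
  apply: (@measurable_fun_cvg _ _ _ _ U); last by move=> t _; exact: Ucvg.
  by move=> n; have [[]] := IU n.
move=> t; apply/ler_addgt0Pl => e e0.
have /cvgrPdist_lt/(_ e e0)[j _ jP] := Ucvg t.
have := jP j (leqnn _) => /=; have [[_ /(_ t) + _ _]] := IU j.
by have := ler_distD (U j t) (v t) 0; rewrite !subr0 /v; lra.
Unshelve. all: by end_near. Qed.

Lemma norm_le_sqrt_sum (a b : R) :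
  `|a| <= Num.sqrt (a ^+ 2 + b ^+ 2) /\ `|b| <= Num.sqrt (a ^+ 2 + b ^+ 2).
Proof.
by split; rewrite -sqrtr_sqr ler_sqrt ?addr_ge0 ?sqr_ge0// ?lerDl ?lerDr sqr_ge0.
Qed.

Lemma sqrt_sum_le (a b d : R) : `|a| <= d -> `|b| <= d ->
  Num.sqrt (a ^+ 2 + b ^+ 2) <= 2 * d.
Proof.
move=> ad bd; have d0 : 0 <= d by exact: le_trans ad.
rewrite -[leRHS]ger0_norm ?mulr_ge0// -sqrtr_sqr ler_sqrt ?sqr_ge0//.
have sq x : `|x| <= d -> x ^+ 2 <= d ^+ 2.
  move=> xd; rewrite -(real_normK (num_real x)).
  by apply: lerXn2r xd; rewrite nnegrE.
have := sq a ad; have := sq b bd; have := sqr_ge0 d; rewrite exprMn.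
by clear; lra.
Qed.

(** The factor [4 / eta] is the ratio between the move [2 c m] of the control in one correction and
    the guaranteed drop [c eta m / 2] of the miss [m]. *)
Lemma reach_of_gain u0 s T E eta r : control u0 -> 0 <= s <= T -> 0 < eta ->
  (forall u, control u -> (forall t, `|u t - u0 t| <= r) ->
     forall phi, - pi <= phi <= pi ->
     exists2 w, control w & eta <= gain phi w u s) ->
  miss E u0 s <= 1 -> 4 / eta * miss E u0 s <= r ->
  exists u, [/\ control u, advance u 0 s = E.1 & advance u (pi / 2) s = E.2].
Proof.
move=> cu0 s0T eta0 near_gain m1 mr.
have T0 : 0 <= T by move: s0T => /andP[]; exact: le_trans.
have M0 : 0 <= 2 / rho * T by rewrite mulr_ge0// divr_ge0// ltW.
have [c [c0 c1 ceta cK]] : exists c, [/\ 0 < c, c <= 1, c * eta <= 1 &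
    c * (4 * (2 / rho * T) ^+ 2 * T + 2 * (2 / rho * T * T) ^+ 2) <= eta].
  have : 0 <= 4 * (2 / rho * T) ^+ 2 * T + 2 * (2 / rho * T * T) ^+ 2.
    apply: addr_ge0; last by rewrite mulr_ge0// sqr_ge0.
    by rewrite mulr_ge0// mulr_ge0// sqr_ge0.
  move: (_ + _) => K K0; have e20 := sqr_ge0 eta.
  have den0 : 0 < K + 1 + eta ^+ 2 + eta by clear -K0 e20 eta0; lra.
  (* The summands [eta], [eta ^+ 2] and [K] of the denominator serve the three upper bounds, in this
     order. *)
  exists (eta / (K + 1 + eta ^+ 2 + eta)); split.
  - exact: divr_gt0.
  - by rewrite ler_pdivrMr// mul1r; clear -K0 e20; lra.
  - by rewrite mulrAC ler_pdivrMr// mul1r -expr2; clear -K0 eta0; lra.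
  - by rewrite mulrAC ler_pdivrMr// ler_pM2l//; clear -K0 e20 eta0; lra.
have ceta0 : 0 < c * eta by exact: mulr_gt0.
have k01 : 0 <= 1 - c * eta / 2 < 1 by clear -ceta ceta0; lra.
have etaN0 : 0 <= 4 / eta by rewrite divr_ge0// ltW.
have [|v [cv vP]] := @iterated_correction (fun u => miss E u s) u0 r _ _ cu0
    etaN0 k01 (fun u => sqrtr_ge0 _) m1 mr.
  move=> u cu ur mu1.
  have [u' [cu' u'u mu']] := correction_step cu s0T (ltW c0) c1 ceta cK mu1
    (near_gain u cu ur).
  exists u'; split=> // t; apply: (le_trans (u'u t)).
  rewrite (_ : 2 * c * _ = 4 / eta * (miss E u s - (1 - c * eta / 2) * miss E u s)).
    by rewrite ler_wpM2l// lerD2l lerN2.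
  by field; rewrite gt_eqF.
set B := 4 / eta / rho * T * T.
have B0 : 0 <= B by rewrite !mulr_ge0// invr_ge0 ltW.
have close (x : R) phi : (forall u, `|x - advance u phi s| <= miss E u s) ->
    advance v phi s = x.
  move=> xU; apply/eqP; rewrite -subr_eq0 -normr_le0; apply/ler_addgt0Pl => e e0.
  have kcvg : (fun n => (1 - c * eta / 2) ^+ n) @ \oo --> 0.
    by apply: cvg_expr; case/andP: k01 => ? ?; rewrite ger0_norm.
  have /cvgrPdist_lt/(_ (e / (B + 1))) := kcvg.
  rewrite divr_gt0//; last by clear -B0; lra.
  move=> /(_ isT)[n _ /(_ n (leqnn _))]/=.
  have [u [cu vu mu]] := vP n.
  have m0 : 0 <= miss E u s by exact: sqrtr_ge0.
  rewrite sub0r normrN ger0_norm; last by rewrite exprn_ge0//; case/andP: k01.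
  move=> /(le_lt_trans mu); rewrite ltr_pdivlMr; last by clear -B0; lra.
  have := advance_dist rho_gt0 phi cv cu s0T vu.
  rewrite (_ : 4 / eta * miss E u s / rho * T * T = B * miss E u s); last by rewrite /B; ring.
  have := xU u; rewrite [`|x - _|]distrC.
  have := ler_distD (advance u phi s) (advance v phi s) x.
  move=> A1 A2 A3 A4; rewrite addr0; apply/(le_trans A1)/(le_trans (lerD A3 A2)).
  by apply/ltW; rewrite mulrDr mulr1 mulrC in A4.
exists v; split=> //; apply: close => u.
  exact: (norm_le_sqrt_sum _ _).1.
exact: (norm_le_sqrt_sum _ _).2.
Qed.

Lemma advance_lipschitz u phi s t : control u -> 0 <= s -> s <= t ->
  `|advance u phi t - advance u phi s| <= t - s.
Proof.
move=> cu s0 st; rewrite /advance (segint_cat _ s0 st); last exact: lbm_cos_heading.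
rewrite addrC addKr -[leRHS]mul1r; apply: normr_segint_le => //.
  exact: lbm_cos_heading.
by move=> x _; exact: cos_max.
Qed.

Lemma gain_lipschitz u w phi phi' T : control u -> control w -> 0 <= T ->
  `|gain phi' w u T - gain phi w u T| <= 2 / rho * T * T * `|phi' - phi|.
Proof.
move=> cu cw T0; rewrite /gain -segintB; [|exact: lbm_gain..].
rewrite mulrAC -[X in _ * X](subr0 T); apply: normr_segint_le => //.
  by apply: lbmB; exact: lbm_gain.
move=> x xT; rewrite -mulrBr normrM; apply: ler_pM => //.
  exact: heading_dist2.
by apply: (le_trans (sin_lipschitz _ _)); rewrite opprB addrA subrK.
Qed.

(** A control that gains in one direction gains at least half as much in nearby ones, by
    [gain_lipschitz]; compactness of [[-pi, pi]] does the rest. *)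
Lemma gain_uniform u T : control u -> 0 <= T ->
  (forall phi, exists2 w, control w & 0 < gain phi w u T) ->
  exists2 eta, 0 < eta & forall phi, - pi <= phi <= pi ->
    exists2 w, control w & eta <= gain phi w u T.
Proof.
move=> cu T0 gw.
set L := 2 / rho * T * T.
have L0 : 0 <= L by rewrite !mulr_ge0// invr_ge0 ltW.
have /compact_near_coveringP cov := @segment_compact R (- pi) pi.
have := cov R (0^'+) (fun e phi => exists2 w, control w & e <= gain phi w u T) _.
case/(_ _) => [phi _|].
  have [w cw g0] := gw phi.
  exists ([set y : R | `|phi - y| < gain phi w u T / 2 / (L + 1)],
          [set e : R | e < gain phi w u T / 2]).
    split=> /=; last by apply: nbhs_right_lt; rewrite divr_gt0.
    by exists (gain phi w u T / 2 / (L + 1)) => //=; rewrite !divr_gt0//; clear -L0; lra.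
  move=> [y e]/= [phiy eg]; exists w => //.
  have := gain_lipschitz phi y cu cw T0; rewrite -/L [`|y - _|]distrC.
  move: phiy; rewrite ltr_pdivlMr; last by clear -L0; lra.
  rewrite ler_norml => A /andP[B _]; have := normr_ge0 (phi - y).
  move: A B eg; rewrite [L * _]mulrC mulrDr; clear; lra.
move=> e /= e0 H; exists (e / 2); first by exact: divr_gt0.
move=> phi phipi; apply: (H (e / 2)) => /=.
- by rewrite sub0r normrN gtr0_norm ?divr_gt0//; clear -e0; lra.
- exact: divr_gt0.
- by rewrite in_itv.
Qed.

(** At time [T - d], the target and the position under [u] are both within [d], in each coordinate,
    of the interception point. A gain in every direction would allow the remaining miss to be
    corrected exactly, hence an earlier interception. *)
Lemma extremal_of_minimal u T (E : R -> R * R) : control u -> 0 < T ->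
  advance u 0 T = (E T).1 -> advance u (pi / 2) T = (E T).2 ->
  (forall s t, 0 <= s -> s <= t ->
    `|(E t).1 - (E s).1| <= t - s /\ `|(E t).2 - (E s).2| <= t - s) ->
  (forall s w, 0 < s -> s < T -> control w ->
    advance w 0 s = (E s).1 -> advance w (pi / 2) s = (E s).2 -> False) ->
  exists phi, forall w, control w -> gain phi w u T <= 0.
Proof.
move=> cu T0 uE1 uE2 lipE minT; apply/not_existsP => gw.
have [|eta eta0 etaP] := @gain_uniform u T cu (ltW T0).
  move=> phi; have /existsNP[w /not_implyP[cw /negP]] := gw phi.
  by rewrite -ltNge; exists w.
have [M M0 ME] : exists2 M, 0 < M & M = 2 / rho * T.
  by exists (2 / rho * T) => //; rewrite mulr_gt0// divr_gt0.
have [r r0 rE] : exists2 r, 0 < r & (1 + M) * (r / rho * T) * T = eta / 4.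
  have M1 : 0 < 1 + M by exact: addr_gt0.
  exists (eta * rho / (4 * (1 + M) * T ^+ 2)).
    by rewrite divr_gt0 ?mulr_gt0 ?exprn_gt0.
  by field; rewrite !gt_eqF.
(* The four bounds give, in order: a positive time [T - d]; a miss [4 d] at most 1; a loss of gain
   at most [eta / 4] from the shorter duration; and [32 d / eta <= r]. Moving the control by [r]
   loses another [eta / 4], so a gain of [eta / 2] is left. *)
pose d := Num.min (Num.min (T / 2) (1 / 4)) (Num.min (eta / (4 * M)) (r * eta / 32)).
have a1 : 0 < T / 2 by exact: divr_gt0.
have a2 : 0 < 1 / 4 :> R by exact: divr_gt0.
have a3 : 0 < eta / (4 * M) by apply: divr_gt0 => //; exact: mulr_gt0.
have a4 : 0 < r * eta / 32 by apply: divr_gt0 => //; exact: mulr_gt0.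
have d0 : 0 < d by rewrite !lt_min a1 a2 a3.
have /andP[/andP[dT d4] /andP[dM dr]] : ((d <= T / 2) && (d <= 1 / 4)) &&
    ((d <= eta / (4 * M)) && (d <= r * eta / 32)) by rewrite -!le_min.
clearbody d.
have s0 : 0 < T - d by clear - T0 dT; lra.
have sT : T - d < T by clear - d0; lra.
have s0T : 0 <= T - d <= T by rewrite !ltW.
have mis : miss (E (T - d)) u (T - d) <= 4 * d.
  have [E1 E2] := lipE _ _ (ltW s0) (ltW sT).
  have A phi := advance_lipschitz phi cu (ltW s0) (ltW sT).
  rewrite (_ : 4 * d = 2 * (2 * d)); last by clear; ring.
  apply: sqrt_sum_le.
    apply: (le_trans (ler_distD (advance u 0 T) _ _)).
    rewrite uE1 [X in X + _]distrC -uE1.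
    by have := A 0; move: E1; rewrite uE1; clear; lra.
  apply: (le_trans (ler_distD (advance u (pi / 2) T) _ _)).
  rewrite uE2 [X in X + _]distrC -uE2.
  by have := A (pi / 2); move: E2; rewrite uE2; clear; lra.
have e20 : 0 < eta / 2 by exact: divr_gt0.
have [w cw wr phi phipi| | |w [cw w1 w2]] :=
  @reach_of_gain u (T - d) T (E (T - d)) (eta / 2) r cu s0T e20.
- have [w' cw' gw'] := etaP phi phipi; exists w'; first exact: cw'.
  apply: le_trans (gain_near phi cu cw cw' s0T wr); rewrite -ME rE.
  have : M * (T - (T - d)) <= eta / 4.
    rewrite (_ : T - (T - d) = d); last by clear; ring.
    by move: dM; rewrite ler_pdivlMr ?mulr_gt0//; clear; lra.
  by move: gw'; clear; lra.
- by apply: (le_trans mis); move: d4; clear; lra.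
- apply: (@le_trans _ _ (4 / (eta / 2) * (4 * d))).
    by rewrite ler_wpM2l// divr_ge0// ltW.
  rewrite (_ : 4 / (eta / 2) * (4 * d) = 32 * d / eta); last first.
    by field; rewrite gt_eqF.
  by rewrite ler_pdivrMr//; move: dr; clear; lra.
exact: (minT _ _ s0 sT cw w1 w2).
Qed.

End Openness.

(** * Bang-bang property of extremals, integrals along arcs *)

Section Extremal.
Context {R : realType} (rho : R) (rho_gt0 : 0 < rho).
Implicit Types (f g u w : R -> R) (a b c s t T sg : R).

Local Notation heading := (heading rho).

Lemma segint_eq_oo f g a b :
  locally_bounded_measurable f -> locally_bounded_measurable g ->
  a <= b -> (forall x, a < x < b -> f x = g x) -> segint f a b = segint g a b.
Proof.
move=> lf lg; rewrite le_eqVlt => /orP[/eqP->|ab fg]; first by rewrite !segintxx.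
have H h : locally_bounded_measurable h -> segint h a b =
    \int[@lebesgue_measure R]_(x in `]a, b[) h x.
  move=> lh; rewrite /segint -Rintegral_itv_obnd_cbnd.
    rewrite -Rintegral_itv_bndo_bndc//.
    apply: integrableS (lbm_integrable a b lh) => //.
    by move=> x /=; rewrite !in_itv/= => /andP[/ltW-> /ltW->].
  apply: integrableS (lbm_integrable a b lh) => //.
  by move=> x /=; rewrite !in_itv/= => /andP[/ltW-> ->].
by rewrite (H _ lf) (H _ lg); apply: eq_Rintegral => x; rewrite inE/= in_itv/= => /fg.
Qed.

Definition overwrite a b sg u t : R := u t + \1_(`]a, b[%classic) t * (sg - u t).

Lemma overwrite_in a b sg u t : a < t < b -> overwrite a b sg u t = sg.
Proof.
move=> tab; rewrite /overwrite indicE mem_set /= ?in_itv//.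
by rewrite mul1r addrC subrK.
Qed.

Lemma overwrite_out a b sg u t : ~~ (a < t < b) -> overwrite a b sg u t = u t.
Proof.
move=> tab; rewrite /overwrite indicE memNset /= ?in_itv//; last exact/negP.
by rewrite mul0r addr0.
Qed.

Lemma control_overwrite a b sg u : `|sg| <= 1 -> control u -> control (overwrite a b sg u).
Proof.
move=> sg1 [mu u1]; split.
  apply: measurable_funD => //; apply: measurable_funM; last exact: measurable_funB.
  exact: measurable_indic.
move=> t; have [tab|tab] := boolP (a < t < b); first by rewrite overwrite_in.
by rewrite overwrite_out.
Qed.

Lemma heading_overwrite_before a b sg u t : `|sg| <= 1 -> control u -> 0 <= t ->
  t <= a -> heading (overwrite a b sg u) t = heading u t.
Proof.
move=> sg1 cu t0 ta; rewrite /heading; congr (_ + _); apply: segint_eq => x /andP[x0 xt].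
by rewrite overwrite_out// negb_and -!leNgt (le_trans xt ta).
Qed.

Lemma heading_overwrite_in a b sg u t : `|sg| <= 1 -> control u -> 0 <= a ->
  a <= t -> t <= b -> heading (overwrite a b sg u) t = heading u a + sg / rho * (t - a).
Proof.
move=> sg1 cu a0 at_ tb; have cp := control_overwrite a b sg1 cu.
rewrite (heading_cat rho cp a0 at_) heading_overwrite_before//; congr (_ + _).
rewrite -segint_cst//; apply: segint_eq_oo => //.
- exact: control_rate_lbm.
- exact: lbm_cst.
- by move=> x /andP[ax xt]; rewrite overwrite_in// ax (lt_le_trans xt).
Qed.

Lemma heading_overwrite_after a b sg u t : `|sg| <= 1 -> control u -> 0 <= a ->
  a <= b -> b <= t -> heading (overwrite a b sg u) t - heading u t =
    heading (overwrite a b sg u) b - heading u b.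
Proof.
move=> sg1 cu a0 ab bt; have cp := control_overwrite a b sg1 cu.
have b0 := le_trans a0 ab.
rewrite (heading_cat rho cp b0 bt) (heading_cat rho cu b0 bt).
rewrite (@segint_eq_oo (fun r => overwrite a b sg u r / rho) (fun r => u r / rho))//.
- by ring.
- exact: control_rate_lbm.
- exact: control_rate_lbm.
- move=> x /andP[bx _]; rewrite overwrite_out// negb_and -!leNgt (ltW bx).
  by rewrite orbT.
Qed.

(** The maximum principle in variational form: to first order, mixing in another control never moves
    the end point forward in direction [phi]. *)
Definition extremal phi T u := forall w, control w -> gain rho phi w u T <= 0.

(* The signed distance from the position at time [t] to the line of direction
   [phi] through the position at time [T]; it is the costate of the heading. *)
Definition offset phi T u t := segint (fun s => sin (phi - heading u s)) t T.

(** The test control is [u] overwritten by [sg] on []a, b[]. Its extra heading [D], times [sg],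
    grows from 0 at [a] to its value at [b] and is constant afterwards, so the gain is
    [D b * offset phi T u b] up to an error [|D b| (b - a)]. Since [b - a < sg * offset phi T u b],
    the gain is positive unless [D b = 0], which is the claim. *)
Lemma bang_bang phi T u sg a b : control u -> extremal phi T u ->
  sg ^+ 2 = 1 -> 0 <= a -> a <= b -> b <= T ->
  b - a < sg * offset phi T u b ->
  heading u b = heading u a + sg / rho * (b - a).
Proof.
move=> cu ext sg2 a0 ab bT near.
have sg1 : `|sg| <= 1 by rewrite -(@expr_le1 _ 2)// real_normK ?num_real// sg2.
have cw := control_overwrite a b sg1 cu; set w := overwrite a b sg u in cw.
have b0 := le_trans a0 ab.
pose D t := heading w t - heading u t.
have lG := lbm_gain rho_gt0 phi cw cu.
have lS := lbm_sin_heading rho_gt0 phi cu.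
have Dlip x : a <= x -> x <= b -> 0 <= sg * D x <= sg * D b.
  move=> ax xb; have bound y z : a <= y -> y <= z -> z <= b -> 0 <= sg * (D z - D y).
    move=> ay yz zb; rewrite /D !heading_overwrite_in// ?(le_trans yz)// ?(le_trans ay)//.
    have y0 := le_trans a0 ay.
    have := heading_lipschitz rho_gt0 y z cu.
    rewrite (ger0_norm (_ : 0 <= z - y)) ?subr_ge0// => H.
    have : sg * (heading u z - heading u y) <= (z - y) / rho.
      apply: (le_trans (ler_norm _)); rewrite normrM; apply: le_trans H.
      by rewrite ler_piMl.
    move=> H2; rewrite [leRHS](_ : _ = sg ^+ 2 * ((z - y) / rho) -
      sg * (heading u z - heading u y)); last by ring.
    by rewrite sg2 mul1r subr_ge0.
  have Da : D a = 0 by rewrite /D heading_overwrite_before// subrr.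
  have := bound a x (lexx _) ax xb; have := bound x b ax xb (lexx _).
  by rewrite Da subr0 mulrBr subr_ge0 => -> ->.
have := ext w cw; rewrite /gain.
rewrite (segint_cat lG a0 (le_trans ab bT)) (segint_cat lG ab bT).
rewrite (@segint_eq _ _ (fun=> 0) 0 a); last first.
  by move=> x /andP[x0 xa]; rewrite heading_overwrite_before// subrr mul0r.
rewrite segint_cst// mul0r add0r.
rewrite (@segint_eq _ _ (fun t => D b * sin (phi - heading u t)) b T); last first.
  by move=> x /andP[bx xT]; rewrite heading_overwrite_after.
rewrite segintZ// -/(offset phi T u b).
have Db0 : 0 <= sg * D b by have /andP[] := Dlip b ab (lexx _).
have head : `|segint (fun t => (heading w t - heading u t) * sin (phi - heading u t)) a b|
    <= sg * D b * (b - a).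
  apply: normr_segint_le => // x /andP[ax xb]; rewrite normrM -[leRHS]mulr1.
  apply: ler_pM => //; last exact: sin_max.
  have /andP[D0 Dx] := Dlip x ax xb.
  have sgn : `|sg| = 1 by apply/eqP; rewrite -(@sqrp_eq1 _ `|sg|)// real_normK ?num_real// sg2.
  by rewrite -[leLHS]mul1r -sgn -normrM ger0_norm.
move=> tot; have Dle : sg * D b * (sg * offset phi T u b) <= sg * D b * (b - a).
  rewrite (_ : _ * (sg * _) = sg ^+ 2 * (D b * offset phi T u b)); last by ring.
  by rewrite sg2 mul1r; move: head tot; rewrite ler_norml => /andP[+ _]; clear; lra.
have Db : D b = 0.
  have [D0|Dpos] := leP (sg * D b) 0.
    have : sg * D b = 0 by apply/eqP; rewrite eq_le D0 Db0.
    move=> /(congr1 (fun x => sg * x)); rewrite mulrA -expr2 sg2 mul1r mulr0.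
    exact.
  by move: Dle; rewrite ler_pM2l// leNgt near.
by move/eqP: Db; rewrite /D subr_eq0 => /eqP <-; rewrite heading_overwrite_in.
Qed.

Lemma sin_taylor1 (x h : R) : `|sin (x + h) - sin x - h * cos x| <= 2 * h ^+ 2.
Proof.
have := cos_taylor1 (x - pi / 2) h.
by rewrite [x - _ + h]addrAC !cosBpihalf sinBpihalf mulrN.
Qed.

Lemma segint_cos_affine x k a b : a <= b -> k != 0 ->
  segint (fun t => cos (x + k * (t - a))) a b = (sin (x + k * (b - a)) - sin x) / k.
Proof.
move=> ab k0.
pose f t := segint (fun t => cos (x + k * (t - a))) a t - sin (x + k * (t - a)) / k.
suff : f a = f b.
  rewrite /f segintxx subrr mulr0 addr0 sub0r => /eqP.
  by rewrite eq_sym subr_eq => /eqP->; ring.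
have lip s t : `|x + k * (t - a) - (x + k * (s - a))| <= `|t - s| * `|k|.
  by rewrite le_eqVlt -normrM; apply/orP; left; apply/eqP; congr `| _ |; ring.
have lc : locally_bounded_measurable (fun t => cos (x + k * (t - a))).
  apply: lbm_continuous => t; apply: continuous_comp; last exact: continuous_cos.
  by apply: (lipschitz_continuous _ lip); rewrite normr_gt0.
(* The constant adds the error [|k|] of freezing the integrand to the Taylor error [2 |k|] of the
   sine. *)
apply: (@eq_of_quadratic_increments R f a b (3 * `|k|)) => // s t as_ st tb.
rewrite /f (segint_cat lc as_ st).
set z := x + k * (s - a).
have -> : x + k * (t - a) = z + k * (t - s) by rewrite /z; ring.
have i1 : `|segint (fun t => cos (x + k * (t - a))) s t - cos z * (t - s)| <=
    `|k| * (t - s) * (t - s).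
  rewrite -(segint_cst (cos z) st) -segintB//; last exact: lbm_cst.
  apply: normr_segint_le => //; first by apply: lbmB => //; exact: lbm_cst.
  move=> r /andP[sr rt]; apply: (le_trans (cos_lipschitz _ _)).
  apply: (le_trans (lip _ _)); rewrite mulrC ler_wpM2l// ger0_norm ?subr_ge0//.
  by rewrite lerD2r.
have i2 : `|(sin (z + k * (t - s)) - sin z - k * (t - s) * cos z) / k| <=
    2 * `|k| * (t - s) ^+ 2.
  rewrite normrM normfV ler_pdivrMr ?normr_gt0//.
  apply: (le_trans (sin_taylor1 _ _)); rewrite exprMn -(real_normK (num_real k)).
  by rewrite le_eqVlt; apply/orP; left; apply/eqP; ring.
rewrite (_ : _ - _ =
   (segint (fun t => cos (x + k * (t - a))) s t - cos z * (t - s)) -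
   (sin (z + k * (t - s)) - sin z - k * (t - s) * cos z) / k); last by field.
apply: (le_trans (ler_normB _ _)).
rewrite (_ : 3 * `|k| * (t - s) ^+ 2 =
  `|k| * (t - s) * (t - s) + 2 * `|k| * (t - s) ^+ 2); last by ring.
exact: lerD.
Qed.

Lemma segint_cos_sweep f x c k a b : a <= b -> k != 0 ->
  (forall t, a <= t <= b -> f t = x + k * (t - a)) ->
  segint (fun t => cos (f t - c)) a b = (sin (f b - c) - sin (f a - c)) / k.
Proof.
move=> ab k0 fE; rewrite (@segint_eq _ _ (fun t => cos (x - c + k * (t - a)))).
  rewrite segint_cos_affine// (fE a) ?lexx// (fE b) ?lexx ?andbT// subrr mulr0 addr0.
  by rewrite [x - c + _]addrAC.
by move=> t tab; rewrite fE// addrAC.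
Qed.

End Extremal.

(** * Structure of extremals *)

Section Switching.
Context {R : realType} (rho T : R) (rho_gt0 : 0 < rho).
(** [psi] stands for the heading measured from [phi] and [Y] for the offset, whose derivative is
    [sin psi]; [bang] is the bang-bang property. *)
Context (psi Y : R -> R).
Context (psi_lip : forall s t, `|psi t - psi s| <= `|t - s| / rho).
Context (YE : forall s t, 0 <= s -> s <= t -> t <= T ->
  Y t - Y s = segint (fun x => sin (psi x)) s t).
Context (Y_lip : forall s t, `|Y t - Y s| <= `|t - s|) (YT : Y T = 0).
Context (bang : forall sg a b, sg ^+ 2 = 1 -> 0 <= a -> a <= b -> b <= T ->
  b - a < sg * Y b -> psi b = psi a + sg / rho * (b - a)).
Implicit Types (a b c s t m z sg : R).

Lemma psi_continuous : continuous psi.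
Proof. by apply: (lipschitz_continuous _ psi_lip); rewrite invr_gt0. Qed.

Lemma sin_psi_continuous : continuous (fun x => sin (psi x)).
Proof.
move=> x; apply: continuous_comp; first exact: psi_continuous.
exact: continuous_sin.
Qed.

Lemma Y_continuous : continuous Y.
Proof.
by apply: (@lipschitz_continuous _ Y 1) => // s t; rewrite mulr1.
Qed.

Lemma exists_zero (f : R -> R) a b : continuous f -> a <= b ->
  f a * f b <= 0 -> exists2 c, a <= c <= b & f c = 0.
Proof.
move=> cf ab fab.
have := @IVT R f a b 0 ab (continuous_subspaceT cf).
have -> : Num.min (f a) (f b) <= 0 <= Num.max (f a) (f b).
  rewrite ge_min le_max; have [fa|fa] := leP (f a) 0 => /=.
    have [//|fa0] := leP 0 (f a) => /=.
    by move: fab; rewrite nmulr_rle0.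
  by move: fab; rewrite pmulr_rle0// (ltW fa) => ->.
by move=> /(_ isT)[c]; rewrite in_itv/=; exists c.
Qed.

Lemma last_zero a b : (exists2 z, a <= z <= b & Y z = 0) ->
  exists c, [/\ a <= c <= b, Y c = 0 & forall t, c < t -> t <= b -> Y t <> 0].
Proof.
case=> z zab Yz.
pose A := `[a, b] `&` (Y @^-1` [set 0]).
have cA : compact A.
  apply: compact_closedI; first exact: segment_compact.
  by apply: preimage_closed; [move=> x _; exact: Y_continuous|exact: closed_eq].
have A0 : A !=set0 by exists z; split => //=; rewrite in_itv.
have cid : continuous (@idfun R) by move=> x; exact: cvg_id.
have [c] := compact_EVT_max A0 cA (continuous_subspaceT cid).
rewrite inE => -[/= cab Yc] cmax; exists c; split=> //.
move=> t ct tb Yt; have := cmax t; rewrite inE leNgt ct => H; apply/notF/H.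
split=> //=; rewrite in_itv/= tb andbT; move: cab; rewrite in_itv/= => /andP[ac _].
exact: (le_trans ac (ltW ct)).
Qed.

Lemma first_zero a b : (exists2 z, a <= z <= b & Y z = 0) ->
  exists c, [/\ a <= c <= b, Y c = 0 & forall t, a <= t -> t < c -> Y t <> 0].
Proof.
case=> z zab Yz.
pose A := `[a, b] `&` (Y @^-1` [set 0]).
have cA : compact A.
  apply: compact_closedI; first exact: segment_compact.
  by apply: preimage_closed; [move=> x _; exact: Y_continuous|exact: closed_eq].
have A0 : A !=set0 by exists z; split => //=; rewrite in_itv.
have cid : continuous (@idfun R) by move=> x; exact: cvg_id.
have [c] := compact_EVT_min A0 cA (continuous_subspaceT cid).
rewrite inE => -[/= cab Yc] cmin; exists c; split=> //.
move=> t at_ tc Yt; have := cmin t; rewrite inE leNgt tc => H; apply/notF/H.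
split=> //=; rewrite in_itv/= at_ /=; move: cab; rewrite in_itv/= => /andP[_ cb].
exact: (le_trans (ltW tc) cb).
Qed.

Lemma sign_constant a b : a < b -> (forall t, a < t < b -> Y t <> 0) ->
  exists sg, (sg = 1 \/ sg = -1) /\ forall t, a < t < b -> 0 < sg * Y t.
Proof.
move=> ab Y0; pose m := (a + b) / 2.
have am : a < m by rewrite /m ltr_pdivlMr//; lra.
have mb : m < b by rewrite /m ltr_pdivrMr//; lra.
have Ym : Y m != 0 by apply/eqP/Y0; rewrite am.
have same t : a < t < b -> 0 < Y m * Y t.
  move=> /andP[at_ tb]; rewrite ltNge; apply/negP => YY.
  have [tm|mt] := leP t m.
    have [|c /andP[tc cm] Yc] := exists_zero Y_continuous tm; first by rewrite mulrC.
    by apply: (Y0 c) => //; rewrite (lt_le_trans at_ tc) (le_lt_trans cm mb).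
  have [c /andP[mc ct] Yc] := exists_zero Y_continuous (ltW mt) YY.
  by apply: (Y0 c) => //; rewrite (lt_le_trans am mc) (le_lt_trans ct tb).
have [Yp|Yn] := ltP 0 (Y m).
  exists 1; split; first by left.
  by move=> t /same; rewrite mul1r pmulr_rgt0.
have {}Yn : Y m < 0 by rewrite lt_neqAle Ym.
exists (-1); split; first by right.
by move=> t /same; rewrite mulN1r nmulr_rgt0// oppr_gt0.
Qed.

Lemma lipschitz_const_closed (f : R -> R) K c a b : a < b ->
  (forall s t, `|f t - f s| <= `|t - s| * K) ->
  (forall t, a < t < b -> f t = c) -> forall t, a <= t <= b -> f t = c.
Proof.
move=> ab fK fc t /andP[at_ tb]; apply/eqP; rewrite -subr_eq0 -normr_le0.
have K0 : 0 <= K by have := le_trans (normr_ge0 _) (fK 0 1); rewrite subr0 normr1 mul1r.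
apply/ler_addgt0Pl => e e0; rewrite addr0.
pose d := Num.min ((b - a) / 4) (e / (K + 1)).
have K1 : 0 < K + 1 by rewrite ltr_pwDr.
have ba : 0 < (b - a) / 4 by rewrite divr_gt0// subr_gt0.
have d0 : 0 < d by rewrite lt_min ba divr_gt0.
have /andP[dab de] : (d <= (b - a) / 4) && (d <= e / (K + 1)) by rewrite -le_min.
clearbody d.
have de' : d * K <= e.
  by move: de; rewrite ler_pdivlMr// mulrDr mulr1; lra.
have [s [sab st]] : exists s, a < s < b /\ `|t - s| <= d.
  have [tm|tm] := leP t ((a + b) / 2).
    exists (t + d); split; first by apply/andP; split; lra.
    by rewrite opprD addNKr normrN gtr0_norm.
  exists (t - d); split; first by apply/andP; split; lra.
  by rewrite opprB addrC subrK gtr0_norm.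
rewrite -(fc s sab); apply: (le_trans (fK _ _)); apply: le_trans de'.
by rewrite ler_wpM2r.
Qed.

(** [bang] only covers intervals shorter than [sg * Y]. On a segment inside []a, b[], [sg * Y] has a
    positive minimum: increments of [psi t - sg / rho * t] over shorter lengths vanish, and over
    longer ones the Lipschitz bound is dominated by a multiple of the squared length. So this
    function is constant there, and up to the end points by continuity. *)
Lemma arc_affine a b : 0 <= a -> a < b -> b <= T ->
  (forall t, a < t < b -> Y t <> 0) ->
  exists sg, [/\ sg = 1 \/ sg = -1, forall t, a <= t <= b -> 0 <= sg * Y t,
    forall t, a < t < b -> 0 < sg * Y t
    & forall t, a <= t <= b -> psi t = psi a + sg / rho * (t - a)].
Proof.
move=> a0 ab bT Y0; have [sg [sg1 sgY]] := sign_constant ab Y0.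
have sg2 : sg ^+ 2 = 1 by case: sg1 => ->; rewrite ?sqrrN expr1n.
have sgn : `|sg| = 1 by case: sg1 => ->; rewrite ?normrN normr1.
pose f t := psi t - sg / rho * t.
have fK s t : `|f t - f s| <= `|t - s| * (2 / rho).
  rewrite /f (_ : _ - _ = (psi t - psi s) - sg / rho * (t - s)); last by ring.
  apply: (le_trans (ler_normB _ _)); rewrite [`|sg / rho * _|]normrM normrM sgn mul1r.
  rewrite normfV (gtr0_norm rho_gt0).
  rewrite (_ : `|t - s| * (2 / rho) = `|t - s| / rho + rho^-1 * `|t - s|); last by ring.
  by rewrite lerD2r.
have fconst s t : a < s -> s <= t -> t < b -> f s = f t.
  move=> as_ st tb.
  have csY : continuous (fun x => sg * Y x).
    by move=> x; apply: continuousM; [exact: cst_continuous|exact: Y_continuous].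
  have [c cst cmin] := EVT_min st (continuous_subspaceT csY).
  have mu0 : 0 < sg * Y c.
    move: cst; rewrite in_itv/= => /andP[sc ct]; apply: sgY.
    by rewrite (lt_le_trans as_ sc) (le_lt_trans ct tb).
  apply: (@eq_of_quadratic_increments R f s t (2 / rho / (sg * Y c))) => // x y sx xy yt.
  have [xyY|xyY] := ltP (y - x) (sg * Y c).
    have ysY : y - x < sg * Y y.
      by apply: (lt_le_trans xyY); apply: cmin; rewrite in_itv/= yt (le_trans sx).
    rewrite /f (bang sg2 (le_trans a0 (ltW (lt_le_trans as_ sx))) xy _ ysY); last first.
      exact: (le_trans yt (le_trans (ltW tb) bT)).
    rewrite (_ : _ - _ = 0); last by ring.
    by rewrite normr0 mulr_ge0 ?sqr_ge0// divr_ge0 ?divr_ge0 ?ltW.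
  apply: (le_trans (fK _ _)); rewrite ger0_norm ?subr_ge0// expr2.
  rewrite mulrC mulrA ler_wpM2r ?subr_ge0//.
  by rewrite mulrAC ler_pdivlMr// ler_wpM2l// divr_ge0// ltW.
pose m := (a + b) / 2.
have am : a < m by rewrite /m ltr_pdivlMr//; lra.
have mb : m < b by rewrite /m ltr_pdivrMr//; lra.
have fm : forall t, a <= t <= b -> f t = f m.
  apply: (lipschitz_const_closed ab fK) => t /andP[at_ tb].
  have [tm|mt] := leP t m; first exact: fconst.
  by rewrite (fconst m t am (ltW mt) tb).
have sgY0 t : a <= t <= b -> 0 <= sg * Y t.
  move=> /andP[at_ tb]; rewrite leNgt; apply/negP => Yt.
  have csY : continuous (fun x => sg * Y x).
    by move=> x; apply: continuousM; [exact: cst_continuous|exact: Y_continuous].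
  have Ym : 0 < sg * Y m by apply: sgY; rewrite am.
  have nz c : a < c < b -> sg * Y c = 0 -> False.
    by move=> /sgY; rewrite lt_neqAle eq_sym => /andP[/eqP].
  have [tm|mt] := leP t m.
    have [|c /andP[tc cm] Yc] := exists_zero csY tm; first by rewrite nmulr_rle0// ltW.
    apply: (nz c) => //; rewrite (le_lt_trans cm mb) andbT lt_neqAle (le_trans at_ tc) andbT.
    apply/eqP => ac; have ct : c = t by apply/eqP; rewrite eq_le tc andbT -ac.
    by move: Yt; rewrite -ct Yc ltxx.
  have [|c /andP[mc ct] Yc] := exists_zero csY (ltW mt); first by rewrite nmulr_lle0// ltW.
  apply: (nz c) => //; rewrite (lt_le_trans am mc) /= lt_neqAle (le_trans ct tb) andbT.
  apply/eqP => cb; have tc : t = c by apply/eqP; rewrite eq_le ct andbT cb.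
  by move: Yt; rewrite tc Yc ltxx.
exists sg; split=> // t tab.
have /eqP := fm t tab; rewrite -(fm a) ?lexx ?(ltW ab)// /f subr_eq => /eqP->.
by ring.
Qed.

Lemma sweep_sin sg a b : a <= b -> sg = 1 \/ sg = -1 ->
  (forall t, a <= t <= b -> psi t = psi a + sg / rho * (t - a)) ->
  segint (fun x => sin (psi x)) a b = rho * sg * (cos (psi a) - cos (psi b)).
Proof.
move=> ab sg1 pE.
have k0 : sg / rho != 0.
  rewrite mulf_neq0//; last by rewrite invr_eq0 gt_eqF.
  by case: sg1 => ->; rewrite ?oppr_eq0 oner_eq0.
have := segint_cos_sweep (pi / 2) ab k0 pE.
rewrite (@segint_eq _ _ (fun x => sin (psi x))); last by move=> x _; exact: cosBpihalf.
move=> ->; rewrite !sinBpihalf invf_div.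
by case: sg1 => ->; field.
Qed.

(** On an arc of sign [sg], the derivatives [sin psi] of [Y] and [- (sg / rho) sin psi] of [cos psi]
    are proportional, and [|Y| = sg * Y]. *)
Lemma arc_energy a b : 0 <= a -> a <= b -> b <= T ->
  (forall t, a < t < b -> Y t <> 0) ->
  cos (psi a) + `|Y a| / rho = cos (psi b) + `|Y b| / rho.
Proof.
move=> a0; rewrite le_eqVlt => /orP[/eqP->//|ab] bT Y0.
have [sg [sg1 sgY _ pE]] := arc_affine a0 ab bT Y0.
have nY t : a <= t <= b -> `|Y t| = sg * Y t.
  move=> /sgY sY; rewrite -(ger0_norm sY) normrM.
  by case: sg1 => ->; rewrite ?normrN normr1 mul1r.
rewrite !nY ?lexx ?(ltW ab)//.
have := YE a0 (ltW ab) bT; rewrite (sweep_sin (ltW ab) sg1 pE) => /eqP.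
rewrite subr_eq => /eqP->.
by case: sg1 => ->; field; rewrite gt_eqF.
Qed.

Lemma rolle_sin a b : 0 <= a -> a < b -> b <= T -> Y a = Y b ->
  exists2 c, a <= c <= b & sin (psi c) = 0.
Proof.
move=> a0 ab bT Yab; have cs := sin_psi_continuous.
have I0 : segint (fun x => sin (psi x)) a b = 0 by rewrite -YE ?(ltW ab)// Yab subrr.
have ba : 0 < b - a by rewrite subr_gt0.
have ls := lbm_continuous cs.
have [c cab cmin] := EVT_min (ltW ab) (continuous_subspaceT cs).
have [d dab dmax] := EVT_max (ltW ab) (continuous_subspaceT cs).
have c0 : sin (psi c) <= 0.
  rewrite -(pmulr_lle0 _ ba) -I0 -segint_cst ?(ltW ab)//.
  by apply: le_segint => //; exact: lbm_cst.
have d0 : 0 <= sin (psi d).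
  rewrite -(pmulr_lge0 _ ba) -I0 -segint_cst ?(ltW ab)//.
  by apply: le_segint => //; exact: lbm_cst.
move: cab dab; rewrite !in_itv/= => /andP[ac cb] /andP[ad db].
have [cd|dc] := leP c d.
  have [|x /andP[cx xd] sx] := exists_zero cs cd; first by rewrite mulr_le0_ge0.
  by exists x => //; rewrite (le_trans ac cx) (le_trans xd db).
have [|x /andP[dx xc] sx] := exists_zero cs (ltW dc); first by rewrite mulr_ge0_le0.
by exists x => //; rewrite (le_trans ad dx) (le_trans xc cb).
Qed.

Lemma cos_quadratic c t : sin (psi c) = 0 ->
  `|cos (psi t) - cos (psi c)| <= 2 / rho ^+ 2 * (t - c) ^+ 2.
Proof.
move=> sc; have := cos_taylor1 (psi c) (psi t - psi c).
rewrite sc mulr0 addr0 [psi c + _]addrC subrK => /le_trans; apply.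
rewrite mulrAC -mulrA ler_wpM2l//.
rewrite -(real_normK (num_real (psi t - psi c))) -(real_normK (num_real (t - c))).
rewrite -expr_div_n; apply: lerXn2r (psi_lip _ _); rewrite nnegrE//.
by rewrite divr_ge0// ltW.
Qed.

(* The conserved quantity is the Hamiltonian of the maximum principle. *)
Lemma energy_constant t : 0 <= t <= T ->
  cos (psi t) + `|Y t| / rho = cos (psi T).
Proof.
move=> /andP[t0 tT]; pose H t := cos (psi t) + `|Y t| / rho.
suff : H t = H T by rewrite /H YT normr0 mul0r addr0.
(* Zeros of [Y] may accumulate in [[x, y]], so only the first and the last, [z1] and [z2], are used.
   [H] is constant outside [[z1, z2]]; between them some [c] has [sin (psi c) = 0], around which
   [cos psi] varies quadratically. *)
apply: (@eq_of_quadratic_increments R H t T (4 / rho ^+ 2)) => //.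
move=> x y tx xy yT; have x0 := le_trans t0 tx.
have K0 : 0 <= 2 / rho ^+ 2 by rewrite divr_ge0// sqr_ge0.
have [ez|nz] := pselect (exists2 z, x <= z <= y & Y z = 0); last first.
  have -> : H x = H y.
    apply: (arc_energy x0 xy yT) => z /andP[/ltW xz /ltW zy] Yz.
    by apply: nz; exists z; rewrite ?xz.
  by rewrite subrr normr0 mulr_ge0 ?sqr_ge0// divr_ge0// sqr_ge0.
have [z1 [/andP[xz1 z1y] Yz1 nz1]] := first_zero ez.
have [z2 [/andP[xz2 z2y] Yz2 nz2]] := last_zero ez.
have Hx : H x = H z1.
  rewrite /H (arc_energy x0 xz1 (le_trans z1y yT))// => z /andP[/ltW].
  exact: nz1.
have Hy : H y = H z2.
  rewrite /H -(arc_energy (le_trans x0 xz2) z2y yT)// => z /andP[z2z /ltW zy].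
  exact: nz2.
rewrite Hx Hy /H Yz1 Yz2 normr0 mul0r !addr0.
have [z12|z21|->] := ltgtP z1 z2; last first.
- by rewrite subrr normr0 mulr_ge0 ?sqr_ge0// divr_ge0// sqr_ge0.
- by exfalso; exact: (nz2 _ z21 z1y Yz1).
have [c /andP[z1c cz2] sc] := rolle_sin (le_trans x0 xz1) z12 (le_trans z2y yT)
  (etrans Yz1 (esym Yz2)).
apply: (le_trans (ler_distD (cos (psi c)) _ _)); rewrite [X in _ + X <= _]distrC.
rewrite (_ : 4 / rho ^+ 2 * (y - x) ^+ 2 =
  2 / rho ^+ 2 * (y - x) ^+ 2 + 2 / rho ^+ 2 * (y - x) ^+ 2); last by ring.
have sq z : x <= z -> z <= y -> (z - c) ^+ 2 <= (y - x) ^+ 2.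
  move=> xz zy; rewrite -(real_normK (num_real (z - c))); apply: lerXn2r.
  - by rewrite nnegrE.
  - by rewrite nnegrE subr_ge0.
  - by rewrite ler_norml; apply/andP; split; lra.
by apply: lerD; apply: (le_trans (cos_quadratic _ sc)); rewrite ler_wpM2l// sq.
Qed.

Lemma offset_zero_of_energy : cos (psi T) = -1 -> forall t, 0 <= t <= T -> Y t = 0.
Proof.
move=> hT t t0T; have := energy_constant t0T; rewrite hT => E.
have YN : `|Y t| / rho <= 0 by have := cos_geN1 (psi t); lra.
by apply/eqP; rewrite -normr_le0; move: YN; rewrite pmulr_lle0// invr_gt0.
Qed.

Lemma energy_at_zero t : 0 <= t <= T -> Y t = 0 -> cos (psi t) = cos (psi T).
Proof. by move=> /energy_constant <- ->; rewrite normr0 mul0r addr0. Qed.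

Definition full_arc a b :=
  [/\ 0 <= a, a < b, b <= T, Y a = 0 /\ Y b = 0 & forall t, a < t < b -> Y t <> 0].

Lemma full_arc_cos_lt a b t : full_arc a b -> a < t < b -> cos (psi t) < cos (psi T).
Proof.
move=> [a0 ab bT _ Y0] tab; have := Y0 t tab => /eqP Yt.
have [/ltW at_ /ltW tb] := andP tab.
have <- := @energy_constant t; last by rewrite (le_trans a0 at_) (le_trans tb bT).
by rewrite ltrDl divr_gt0// normr_gt0.
Qed.

Lemma full_arc_affine a b : full_arc a b -> exists sg, (sg = 1 \/ sg = -1) /\
  forall t, a <= t <= b -> psi t = psi a + sg / rho * (t - a).
Proof.
move=> [a0 ab bT _ Y0]; have [sg [sg1 _ _ pE]] := arc_affine a0 ab bT Y0.
by exists sg.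
Qed.

(** The energy is the same at both ends, so [sin (psi m) * sin d = 0] with [m] the midpoint and [d]
    half the angle swept. Either [cos (psi m) = -1], hence [cos (psi T) = - cos d], or [|d|] is at
    least [pi]. *)
Lemma full_arc_length a b : full_arc a b ->
  2 * rho ^+ 2 * (1 + cos (psi T)) <= (b - a) ^+ 2.
Proof.
move=> fab; have [sg [sg1 pE]] := full_arc_affine fab.
have [a0 ab bT [Ya Yb] _] := fab.
have hE z : 0 <= z <= T -> Y z = 0 -> cos (psi z) = cos (psi T) := @energy_at_zero z.
pose m := (a + b) / 2; pose d := sg / rho * ((b - a) / 2).
have mab : a < m < b by rewrite /m ltr_pdivlMr// ltr_pdivrMr//; apply/andP; split; lra.
have mlt := full_arc_cos_lt fab mab.
have [/ltW am /ltW mb] := andP mab.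
have pa : psi a = psi m - d by rewrite (pE m) ?am// /d /m; field; rewrite gt_eqF.
have pb : psi b = psi m + d.
  by rewrite (pE m) ?am// (pE b) ?lexx ?(ltW ab)// /d /m; field; rewrite gt_eqF.
have ca : cos (psi m - d) = cos (psi T).
  by rewrite -pa hE// a0 (le_trans (ltW ab)).
have cb : cos (psi m + d) = cos (psi T).
  by rewrite -pb hE// bT (le_trans a0 (ltW ab)).
have rb : 0 < (b - a) / 2 / rho by rewrite !divr_gt0// subr_gt0.
have sind : `|sin d| = `|sin ((b - a) / 2 / rho)|.
  rewrite /d (_ : _ * _ = sg * ((b - a) / 2 / rho)); last by field; rewrite gt_eqF.
  by case: sg1 => ->; rewrite ?mul1r// mulN1r sinN normrN.
have cosd : cos d = cos ((b - a) / 2 / rho).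
  rewrite /d (_ : _ * _ = sg * ((b - a) / 2 / rho)); last by field; rewrite gt_eqF.
  by case: sg1 => ->; rewrite ?mul1r// mulN1r cosN.
have c2 : 2 * cos (psi T) = 2 * (cos (psi m) * cos d).
  by rewrite -{1}[2]/(1 + 1) mulrDl mul1r -{1}ca -cb cosB cosD; ring.
have /eqP : sin (psi m) * sin d = 0.
  by have := ca; rewrite -cb cosB cosD; lra.
have r2 : 0 < rho ^+ 2 by exact: exprn_gt0.
pose y := (b - a) / 2 / rho.
have yE : (b - a) ^+ 2 = 4 * (rho ^+ 2 * y ^+ 2) by rewrite /y; field; rewrite gt_eqF.
rewrite mulf_eq0 => /orP[/eqP sm|].
  have cm : cos (psi m) = -1.
    have := sin0cos1 sm; have := cos_le1 (psi T).
    by case: ger0P => c0 ? ?; lra.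
  have := cos_taylor1 0 y; rewrite add0r cos0 sin0 mulr0 addr0 -cosd.
  rewrite ler_norml => /andP[C _].
  have : rho ^+ 2 * (1 + cos (psi T)) <= rho ^+ 2 * (2 * y ^+ 2).
    by rewrite ler_pM2l//; move: c2; rewrite cm; lra.
  by rewrite yE; lra.
rewrite -normr_eq0 sind normr_eq0 => /eqP sy.
have py : 2 <= y.
  rewrite (le_trans (@pi_ge2 R))// leNgt; apply/negP => yp.
  by have := @sin_gt0_pi R y; rewrite rb yp sy ltxx => /(_ isT).
have : rho ^+ 2 * (1 + cos (psi T)) <= rho ^+ 2 * 2.
  by rewrite ler_pM2l//; have := cos_le1 (psi T); lra.
have : rho ^+ 2 * (2 ^+ 2) <= rho ^+ 2 * y ^+ 2.
  by rewrite ler_pM2l//; apply: lerXn2r py; rewrite nnegrE// ltW.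
by rewrite yE; lra.
Qed.

(* Full arcs have a length bounded below, so the zeros of [Y] cannot accumulate
   at [m] unless [Y] vanishes on an interval. *)
Lemma before_zero m : -1 < cos (psi T) -> 0 < m -> m <= T -> Y m = 0 ->
  [\/ exists d, [/\ 0 < d, d <= m & forall t, m - d <= t <= m -> Y t = 0],
      forall t, 0 <= t < m -> Y t <> 0
    | exists a, full_arc a m].
Proof.
move=> hT m0 mT Ym.
have hT1 : 0 < 1 + cos (psi T) by lra.
have r2 : 0 < rho ^+ 2 by exact: exprn_gt0.
(* As [d ^+ 2 <= d], no full arc fits into the last [d] units of time before [m]: if [Y] has a zero
   there before [m], it vanishes from that zero to [m]. *)
pose d := Num.min m (Num.min 1 (rho ^+ 2 * (1 + cos (psi T)))).
have rh : 0 < rho ^+ 2 * (1 + cos (psi T)) by exact: mulr_gt0.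
have d0 : 0 < d by rewrite !lt_min m0 ltr01 rh.
have /andP[dm /andP[d1 dr]] :
    (d <= m) && ((d <= 1) && (d <= rho ^+ 2 * (1 + cos (psi T)))).
  by rewrite -!le_min.
clearbody d.
have dd : d ^+ 2 < 2 * rho ^+ 2 * (1 + cos (psi T)).
  have : d * d <= d by rewrite ler_piMr// ltW.
  by rewrite expr2; lra.
have [[z /andP[zm zlt] Yz]|nz] := pselect (exists2 z, m - d <= z < m & Y z = 0).
  apply: Or31; exists (m - z); split; [lra|lra|].
  move=> t; rewrite (_ : m - (m - z) = z) => [/andP[zt tm]|]; last by ring.
  apply: contrapT => Yt.
  have [z1 [/andP[zz1 z1t] Yz1 nz1]] : exists c, [/\ z <= c <= t, Y c = 0
      & forall x, c < x -> x <= t -> Y x <> 0].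
    by apply: last_zero; exists z; rewrite ?lexx.
  have [z2 [/andP[tz2 z2m] Yz2 nz2]] : exists c, [/\ t <= c <= m, Y c = 0
      & forall x, t <= x -> x < c -> Y x <> 0].
    by apply: first_zero; exists m; rewrite ?lexx ?andbT.
  have z1t' : z1 < t by rewrite lt_neqAle z1t andbT; apply/eqP => E; rewrite -E in Yt.
  have tz2' : t < z2 by rewrite lt_neqAle tz2 andbT; apply/eqP => E; rewrite E in Yt.
  have /full_arc_length : full_arc z1 z2.
    split=> //; [lra|lra|lra|] => x /andP[z1x xz2].
    by have [xt|tx] := leP x t; [exact: nz1|exact: nz2 (ltW tx) xz2].
  have : (z2 - z1) ^+ 2 <= d ^+ 2 by apply: lerXn2r; rewrite ?nnegrE; lra.
  by lra.
have [ez|nz'] := pselect (exists2 z, 0 <= z <= m - d & Y z = 0).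
  apply: Or33; have [c [/andP[c0 cm] Yc nzc]] := last_zero ez.
  exists c; split=> //; first by lra.
  move=> t /andP[ct tm] Yt; have [td|dt] := leP t (m - d); first exact: nzc Yt.
  by apply: nz; exists t => //; rewrite (ltW dt).
apply: Or32 => t /andP[t0 tm] Yt; have [td|dt] := leP t (m - d).
  by apply: nz'; exists t => //; rewrite t0.
by apply: nz; exists t => //; rewrite (ltW dt).
Qed.

Lemma sin_eq0_le_pi (x : R) : 0 < x -> x <= pi -> sin x = 0 -> x = pi.
Proof.
move=> x0 xp sx; apply/eqP; rewrite eq_le xp leNgt; apply/negP => xlt.
by have := @sin_gt0_pi R x; rewrite x0 xlt sx ltxx => /(_ isT).
Qed.

(** The arc starts and ends where [cos psi = 1] and stays below 1 in between, so it sweeps exactly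
    one turn. *)
Lemma full_arc_circle a b : full_arc a b -> cos (psi T) = 1 ->
  b - a = rho * (pi *+ 2).
Proof.
move=> fab hT; have [sg [sg1 pE]] := full_arc_affine fab.
have [a0 ab bT [Ya Yb] _] := fab.
have ca : cos (psi a) = 1 by rewrite -hT energy_at_zero// a0 (le_trans (ltW ab)).
have sa : sin (psi a) = 0 by apply/cos1sin0; rewrite ca normr1.
have cb : cos (psi b) = 1 by rewrite -hT energy_at_zero// bT (le_trans a0 (ltW ab)).
have cE t : a <= t <= b -> cos (psi t) = cos ((t - a) / rho).
  move=> tab; rewrite (pE t tab) cosD ca sa mul1r mul0r subr0.
  rewrite (_ : sg / rho * (t - a) = sg * ((t - a) / rho)); last by field; rewrite gt_eqF.
  by case: sg1 => ->; rewrite ?mul1r// mulN1r cosN.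
have x0 : 0 < (b - a) / rho by rewrite divr_gt0// subr_gt0.
have x2 : (b - a) / rho <= pi *+ 2.
  rewrite leNgt; apply/negP; rewrite ltr_pdivlMr// => lt2.
  have p0 : 0 < pi *+ 2 * rho by rewrite mulr_gt0// pmulrn_lgt0// pi_gt0.
  have tab : a < a + pi *+ 2 * rho < b by apply/andP; split; lra.
  have := full_arc_cos_lt fab tab; have [/ltW at_ /ltW tb] := andP tab.
  rewrite cE ?at_// (_ : (a + _ - a) / rho = pi *+ 2).
    by rewrite cos2pi hT ltxx.
  by rewrite addrC addKr mulfK// gt_eqF.
have : sin ((b - a) / rho / 2) = 0.
  have := cE b; rewrite lexx (ltW ab) cb => /(_ isT).
  rewrite {1}(_ : (b - a) / rho = ((b - a) / rho / 2) *+ 2); last first.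
    by rewrite -mulr_natr divfK.
  rewrite cos_mulr2n cos2sin2 => /esym H; apply/eqP; rewrite -sqrf_eq0; apply/eqP.
  by move: H; rewrite -mulr_natr; lra.
move=> /sin_eq0_le_pi; rewrite divr_gt0// => /(_ isT).
rewrite ler_pdivrMr// mulr_natr => /(_ x2) E.
by rewrite -E -mulr_natr; field; rewrite gt_eqF.
Qed.

(** The two inequalities give [|sin c * sin x| <= cos c * (1 - cos x)], whose left side would be of
    order [x] and right side of order [x ^+ 2]. *)
Lemma sin_eq0_of_cos_max (c x0 : R) : 0 < x0 ->
  (forall x, 0 < x < x0 -> cos (c - x) < cos c /\ cos (c + x) < cos c) -> sin c = 0.
Proof.
move=> x00 cmax; apply/eqP; rewrite -normr_eq0; apply/negP => /negP S0.
have Sp : 0 < `|sin c| by rewrite lt_neqAle eq_sym S0 normr_ge0.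
have S1 := sin_max c.
pose x := Num.min (x0 / 2) (`|sin c| / 8).
have xp : 0 < x by rewrite lt_min !divr_gt0.
have /andP[xx0 xS] : (x <= x0 / 2) && (x <= `|sin c| / 8) by rewrite -le_min.
clearbody x.
have [] := cmax x; first by apply/andP; split; lra.
rewrite cosB cosD => c1 c2.
have cc : `|sin c * sin x| <= cos c * (1 - cos x).
  by rewrite ler_norml; apply/andP; split; lra.
have : cos c * (1 - cos x) <= 2 * x ^+ 2.
  apply: (le_trans (ler_norm _)); rewrite normrM -[leRHS]mul1r ler_pM ?cos_max//.
  by have := cos_taylor1 0 x; rewrite add0r cos0 sin0 mulr0 addr0 distrC.
have sx : x - 2 * x ^+ 2 <= `|sin x|.
  have := sin_taylor1 0 x; rewrite add0r cos0 sin0 mulr1 subr0 ler_norml => /andP[+ _].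
  by have := ler_norm (sin x); lra.
have : `|sin c| * (x - 2 * x ^+ 2) <= `|sin c| * `|sin x| by rewrite ler_pM2l.
move: cc; rewrite normrM.
have : `|sin c| * x ^+ 2 <= 1 * x ^+ 2 by rewrite ler_wpM2r// sqr_ge0.
have : x * x <= `|sin c| / 8 * x by rewrite ler_wpM2r// ltW.
have : 0 < `|sin c| * x by exact: mulr_gt0.
by rewrite expr2; lra.
Qed.

(** With equal signs, [psi] crosses [psi b] at constant rate and [cos psi] has a strict maximum
    there; so [sin (psi b) = 0], the energy is 1 and both arcs are circles. With opposite signs,
    [psi] is symmetric about [b], and unequal lengths would put the far end of the shorter arc
    opposite an interior point of the longer one, where the cosine is smaller. *)
Lemma full_arcs_equal a b c sg sg' : full_arc a b -> full_arc b c ->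
  -1 < cos (psi T) -> sg = 1 \/ sg = -1 -> sg' = 1 \/ sg' = -1 ->
  (forall t, a <= t <= b -> psi t = psi a + sg / rho * (t - a)) ->
  (forall t, b <= t <= c -> psi t = psi b + sg' / rho * (t - b)) ->
  c - b = b - a /\ (sg' = sg -> b - a = rho * (pi *+ 2)).
Proof.
move=> fab fbc hT sg1 sg1' pE pE'.
have [a0 ab bT [Ya Yb] _] := fab; have [b0 bc cT [_ Yc] _] := fbc.
have zE z : 0 <= z <= T -> Y z = 0 -> cos (psi z) = cos (psi T) by exact: energy_at_zero.
have ca : cos (psi a) = cos (psi T) by rewrite zE// a0 (le_trans (ltW ab)).
have cb : cos (psi b) = cos (psi T) by rewrite zE// b0.
have cc : cos (psi c) = cos (psi T) by rewrite zE// cT (le_trans b0 (ltW bc)).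
have [ss|ss] : sg' = sg \/ sg' = - sg.
- by case: sg1 => ->; case: sg1' => ->; rewrite ?opprK; [left|right|right|left].
- suff hT1 : cos (psi T) = 1.
    have := full_arc_circle fab hT1; have := full_arc_circle fbc hT1.
    by move=> -> ->.
  have sb : sin (psi b) = 0.
    apply: (@sin_eq0_of_cos_max _ (Num.min (b - a) (c - b) / rho)).
      by rewrite divr_gt0// lt_min !subr_gt0 ab bc.
    move=> x /andP[x0]; rewrite ltr_pdivlMr// lt_min => /andP[xa xc].
    have xr : 0 < x * rho by exact: mulr_gt0.
    have t1 : a < b - x * rho < b by apply/andP; split; lra.
    have t2 : b < b + x * rho < c by apply/andP; split; lra.
    have := full_arc_cos_lt fab t1; have := full_arc_cos_lt fbc t2.
    rewrite -cb (pE' (b + x * rho)); last by case/andP: t2 => /ltW-> /ltW->.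
    have -> : psi (b - x * rho) = psi b - sg * x.
      rewrite (pE b) ?lexx ?ltW// (pE (b - x * rho)); last by case/andP: t1 => /ltW-> /ltW->.
      by field; rewrite gt_eqF.
    rewrite ss (_ : psi b + sg / rho * (b + x * rho - b) = psi b + sg * x); last first.
      by field; rewrite gt_eqF.
    by case: sg1 => ->; rewrite ?mul1r ?mulN1r ?opprK.
  have := sin0cos1 sb; rewrite cb.
  by move: hT; case: ger0P => // _ + E; rewrite -E opprK ltxx.
- split; last by move=> E; move: ss; rewrite E => ss; exfalso; case: sg1 => sgE; lra.
  have E x : 0 <= x -> x <= c - b -> x <= b - a -> psi (b + x) = psi (b - x).
    move=> x0 xc xa; rewrite (pE' (b + x)); last by apply/andP; split; lra.
    rewrite (pE b) ?lexx ?ltW// (pE (b - x)); last by apply/andP; split; lra.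
    by rewrite ss; field; rewrite gt_eqF.
  apply/eqP; rewrite eq_le; apply/andP; split; rewrite leNgt; apply/negP => lt.
    have tab : b < b + (b - a) < c by apply/andP; split; lra.
    have := full_arc_cos_lt fbc tab; rewrite E; [|lra|lra|lra].
    by rewrite (_ : b - (b - a) = a) ?ca ?ltxx//; ring.
  have tab : a < b - (c - b) < b by apply/andP; split; lra.
  have := full_arc_cos_lt fab tab; rewrite -E; [|lra|lra|lra].
  by rewrite (_ : b + (c - b) = c) ?cc ?ltxx//; ring.
Qed.


(** A zero of [sin psi], given by [rolle_sin], makes the energy 1 or -1, so [sin psi] vanishes on
    all of [[a, b]]. Over a time less than [rho], [psi] moves by less than 1, too little to pass
    between multiples of [pi]. *)
Lemma straight_of_zero a b : 0 <= a -> a < b -> b <= T ->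
  (forall t, a <= t <= b -> Y t = 0) ->
  `|cos (psi T)| = 1 /\ forall t, a <= t <= b -> psi t = psi a.
Proof.
move=> a0 ab bT Y0.
have cE t : a <= t <= b -> cos (psi t) = cos (psi T).
  move=> tab; apply: energy_at_zero; last exact: Y0.
  by case/andP: tab => at_ tb; rewrite (le_trans a0 at_) (le_trans tb bT).
have [|c cab sc] := rolle_sin a0 ab bT.
  by rewrite !Y0 ?lexx ?(ltW ab).
have c1 : `|cos (psi T)| = 1 by rewrite -(cE c cab); exact: sin0cos1.
split=> // t tab.
have s0 x : a <= x <= b -> sin (psi x) = 0.
  by move=> xab; apply: cos1sin0; rewrite cE.
case/andP: tab => at_ tb; apply/esym.
apply: (@eq_of_quadratic_increments R psi a t (rho ^- 2)) => // x y ax xy yt.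
have [lt|ge] := ltP (y - x) rho.
  suff -> : psi y - psi x = 0 by rewrite normr0 mulr_ge0 ?sqr_ge0// invr_ge0 sqr_ge0.
  have d1 : `|psi y - psi x| < 1.
    apply: (le_lt_trans (psi_lip _ _)); rewrite ltr_pdivrMr// mul1r.
    by rewrite ger0_norm// subr_ge0.
  have sd : sin `|psi y - psi x| = 0.
    have : sin (psi y - psi x) = 0.
      by rewrite sinB !s0 ?mul0r ?mulr0 ?subrr//; apply/andP; split; lra.
    by case: ger0P => // _; rewrite sinN => ->; rewrite oppr0.
  apply/eqP; rewrite -normr_eq0; apply/negP => /negP d0.
  have dp : 0 < `|psi y - psi x| by rewrite lt_neqAle eq_sym d0 normr_ge0.
  have := @sin_gt0_pi R `|psi y - psi x|; rewrite dp sd ltxx /= => /(_ _)/notF; apply.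
  by apply: (lt_le_trans d1); have := @pi_ge2 R; lra.
apply: (le_trans (psi_lip _ _)); rewrite ger0_norm ?subr_ge0//.
rewrite mulrC expr2 mulrA ler_wpM2r ?subr_ge0//.
by rewrite invfM -mulrA -[leLHS]mulr1 ler_pM2l ?invr_gt0// mulrC ler_pdivlMr// mul1r.
Qed.

(** The final flat interval is taken maximal, which rules out the first alternative of [before_zero]
    at its start [m]. *)
Lemma flat_end d : 0 < d -> d <= T -> (forall t, T - d <= t <= T -> Y t = 0) ->
  exists m, [/\ 0 <= m, m < T, forall t, m <= t <= T -> Y t = 0
    & forall e, 0 < e -> e <= m -> exists2 t, m - e <= t <= m & Y t <> 0].
Proof.
move=> d0 dT Yd.
pose S := [set s | 0 <= s <= T /\ forall t, s <= t <= T -> Y t = 0].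
have Sd : S (T - d) by split => //; apply/andP; split; lra.
have hS : has_inf S by split; [exists (T - d)|exists 0 => s [/andP[]]].
have m0 : 0 <= inf S by apply: lb_le_inf => [|s [/andP[]]//]; exists (T - d).
have md : inf S <= T - d by apply: ge_inf => //; exact: hS.2.
have mT : inf S < T by lra.
have Ym : forall t, inf S <= t <= T -> Y t = 0.
  apply: (lipschitz_const_closed (f := Y) (K := 1)) => //; first by move=> s t; rewrite mulr1.
  move=> t /andP[mt tT].
  have tm : 0 < t - inf S by rewrite subr_gt0.
  have [s [s0T Ss] st] := inf_adherent tm hS.
  by apply: Ss; apply/andP; split; lra.
exists (inf S); split=> // e e0 em; apply: contrapT => ne.
have : S (inf S - e).
  split; first by apply/andP; split; lra.
  move=> t /andP[et tT]; have [tm|/ltW tm] := leP t (inf S).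
    by apply: contrapT => Yt; apply: ne; exists t; rewrite ?et.
  by apply: Ym; rewrite tm.
by move=> /(ge_inf hS.2); lra.
Qed.

Definition turn sg a b := (sg = 1 \/ sg = -1) /\
  forall t, a <= t <= b -> psi t = psi a + sg / rho * (t - a).

Definition straight a b := forall t, a <= t <= b -> psi t = psi a.

(** [before_zero] is applied at [T], then at the start of the last piece. The first pattern
    describes the whole trajectory; the others only its last two pieces, whatever comes before
    [a]. *)
Lemma switching_patterns : 0 < T ->
  [\/ exists c sg, [/\ 0 <= c <= T, turn sg 0 c
        & straight c T \/ exists sg', turn sg' c T],
      exists a b sg sg', [/\ 0 <= a < b, b < T, turn sg a b /\ turn sg' b T,
        T - b = b - a & sg' = sg -> b - a = rho * (pi *+ 2)],
      exists a b sg, [/\ 0 <= a < b, b < T, turn sg a b, straight b T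
        & b - a = rho * (pi *+ 2)]
    | exists a b sg, [/\ 0 <= a < b, b < T, straight a b, turn sg b T
        & T - b = rho * (pi *+ 2)]].
Proof.
move=> T0.
have turn0 a : turn 1 a a.
  split; first by left.
  by move=> t /le_anti <-; rewrite subrr mulr0 addr0.
have straight0 a : straight a a by move=> t /le_anti <-.
have [hT|hT] := ltP (-1) (cos (psi T)); last first.
  have hN : cos (psi T) = -1 by apply/eqP; rewrite eq_le hT cos_geN1.
  (* With energy [-1] the whole trajectory is straight; the initial turn is the empty one at 0. *)
  apply: Or41; exists 0, 1; split=> //; first by rewrite lexx ltW.
  by left; apply: (straight_of_zero (lexx _) T0 (lexx _) (offset_zero_of_energy hN)).2.
have circle a b : `|cos (psi T)| = 1 -> full_arc a b -> b - a = rho * (pi *+ 2).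
  move=> h1 fab; apply: full_arc_circle => //.
  by move: h1 hT; case: ger0P => // _ <-; rewrite opprK ltxx.
have initial c : 0 <= c -> c <= T -> (forall t, 0 <= t < c -> Y t <> 0) ->
    exists sg, turn sg 0 c.
  rewrite le_eqVlt => /orP[/eqP<- _ _|c0 cT nz]; first by exists 1.
  have [|sg [sg1 _ _ pE]] := arc_affine (lexx _) c0 cT; last by exists sg.
  by move=> t /andP[/ltW t0 tc]; apply: nz; rewrite t0.
have [[d [d0 dT Yd]]|nz|[a fa]] := before_zero hT T0 (lexx _) YT.
- have [m [m0 mT Ym nm]] := flat_end d0 dT Yd.
  have [h1 st] := straight_of_zero m0 mT (lexx _) Ym.
  have Ym0 : Y m = 0 by apply: Ym; rewrite lexx ltW.
  have [m00|mp] := leP m 0.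
    have mE : m = 0 by apply/eqP; rewrite eq_le m00 m0.
    apply: Or41; exists 0, 1; split=> //; first by rewrite lexx ltW.
    by left; rewrite -mE.
  have [[e [e0 em Ye]]|nz|[a fa]] := before_zero hT mp (ltW mT) Ym0.
  + by have [t tm] := nm e e0 em; rewrite Ye.
  + have [sg tsg] := initial m m0 (ltW mT) nz.
    by apply: Or41; exists m, sg; split=> //; [rewrite m0 ltW|left].
  + have [sg [sg1 pE]] := full_arc_affine fa; have [a0 am _ _ _] := fa.
    by apply: Or43; exists a, m, sg; split=> //; [rewrite a0|exact: circle].
- have [sg tsg] := initial T (ltW T0) (lexx _) nz.
  by apply: Or41; exists T, sg; split=> //; [rewrite lexx ltW|left].
have [sg' [sg1' pE']] := full_arc_affine fa; have [a0 aT _ [Ya _] _] := fa.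
have ta : turn sg' a T by [].
have [a00|ap] := leP a 0.
  have aE : a = 0 by apply/eqP; rewrite eq_le a00 a0.
  apply: Or41; exists 0, 1; split=> //; first by rewrite lexx ltW.
  by right; exists sg'; rewrite -aE.
have [[e [e0 ea Ye]]|nz|[a' fa']] := before_zero hT ap (ltW aT) Ya.
- have ae : a - e < a by lra.
  have ae0 : 0 <= a - e by lra.
  have [h1 st] := straight_of_zero ae0 ae (ltW aT) Ye.
  by apply: Or44; exists (a - e), a, sg'; split=> //; [rewrite ae0|exact: circle].
- have [sg tsg] := initial a a0 (ltW aT) nz.
  by apply: Or41; exists a, sg; split=> //; [rewrite a0 ltW|right; exists sg'].
have [sg [sg1 pE]] := full_arc_affine fa'; have [a0' aa _ _ _] := fa'.
have [eq1 eq2] := full_arcs_equal fa' fa hT sg1 sg1' pE pE'.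
by apply: Or42; exists a', a, sg, sg'; split=> //; rewrite a0'.
Qed.

End Switching.

(** * Companion trajectories *)

Section LoopProfile.
Context {R : realType}.
Implicit Types (x y m : R).

Lemma cos_triple x : cos (3 * x) = 4 * cos x ^+ 3 - 3 * cos x.
Proof.
have -> : 3 * x = x *+ 2 + x by rewrite -mulr_natl; ring.
rewrite cosD cos_mulr2n sin_mulr2n.
transitivity ((2 * cos x ^+ 2 - 1) * cos x - 2 * cos x * sin x ^+ 2); first by ring.
by rewrite sin2cos2; ring.
Qed.

Lemma sin_triple x : sin (3 * x) = 3 * sin x - 4 * sin x ^+ 3.
Proof.
have -> : 3 * x = x *+ 2 + x by rewrite -mulr_natl; ring.
rewrite sinD cos_mulr2n sin_mulr2n.
transitivity (2 * cos x ^+ 2 * sin x + (2 * cos x ^+ 2 - 1) * sin x); first by ring.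
by rewrite cos2sin2; ring.
Qed.

Lemma one_sub_cos_le x : 1 - cos x <= x ^+ 2 / 2.
Proof.
have -> : 1 - cos x = 2 * sin (x / 2) ^+ 2.
  by rewrite {1}(_ : x = (x / 2) *+ 2) ?cos_mulr2n ?cos2sin2; [ring|rewrite -mulr_natr; field].
have : sin (x / 2) ^+ 2 <= (x / 2) ^+ 2.
  rewrite -(real_normK (num_real (sin _))) -(real_normK (num_real (x / 2))).
  by apply: lerXn2r (normr_sin_le _); rewrite nnegrE.
by rewrite expr_div_n; lra.
Qed.

Lemma sub_sin_cube x : 0 <= x -> 0 <= x - sin x <= x ^+ 3 / 2.
Proof.
move=> x0; have [c] := @MVT_segment R sin cos 0 x x0 (fun y _ => is_derive_sin y)
  (continuous_subspaceT (@continuous_sin R)).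
rewrite sin0 !subr0 in_itv/= => /andP[c0 cx] ->.
rewrite -[X in X - _]mul1r -mulrBl; apply/andP; split.
  by rewrite mulr_ge0// subr_ge0 cos_le1.
rewrite (_ : x ^+ 3 / 2 = x ^+ 2 / 2 * x); last by ring.
rewrite ler_wpM2r//; apply: (le_trans (one_sub_cos_le c)).
by rewrite ler_pM2r// lerXn2r ?nnegrE.
Qed.

Lemma sub_sin_triple x : 3 * x - sin (3 * x) = 3 * (x - sin x) + 4 * sin x ^+ 3.
Proof. by rewrite sin_triple; ring. Qed.

Lemma sin_lower x : 0 < x -> x <= 1 / 2 -> 7 / 8 * x <= sin x.
Proof.
move=> x0 x1; have /andP[_] := sub_sin_cube (ltW x0).
have : x ^+ 3 <= x * (1 / 2) ^+ 2.
  rewrite exprS ler_pM2l// lerXn2r ?nnegrE// ltW//.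
by lra.
Qed.

(* The crude bound [x - sin x <= x ^+ 3 / 2] at [x = m / 3] improves through the
   triple-angle identity to a bound at [m] close enough to [m ^+ 3 / 6]. *)
Lemma sub_sin_bounds m : 0 < m -> m <= 1 / 2 ->
  m ^+ 3 / 11 <= m - sin m /\ 10 * (m - sin m) < 4 * sin m ^+ 3.
Proof.
move=> m0 m1; have y0 : 0 < m / 3 by exact: divr_gt0.
have m3 : 0 < m ^+ 3 by exact: exprn_gt0.
have y3 : (m / 3) ^+ 3 = m ^+ 3 / 27 by rewrite expr_div_n; congr (_ / _); ring.
have cube x z : 0 <= x -> x <= z -> x ^+ 3 <= z ^+ 3.
  by move=> x0 xz; rewrite lerXn2r// nnegrE// (le_trans x0).
have := sub_sin_triple (m / 3); rewrite (_ : 3 * (m / 3) = m); last by field.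
have /andP[g0 g1] := sub_sin_cube (ltW y0).
have s0 : 7 / 8 * (m / 3) <= sin (m / 3) by apply: sin_lower => //; lra.
have s1 : sin (m / 3) <= m / 3 by lra.
have sy0 : 0 <= sin (m / 3) by lra.
have yy0 : 0 <= 7 / 8 * (m / 3) by lra.
have := cube _ _ sy0 s1; have := cube _ _ yy0 s0.
have ss := sin_lower m0 m1; have mm0 : 0 <= 7 / 8 * m by lra.
have := cube _ _ mm0 ss.
rewrite [(7 / 8 * m) ^+ 3]exprMn [(7 / 8 * (m / 3)) ^+ 3]exprMn y3 => A B C ->; rewrite y3 in g1.
have E : (7 / 8 : R) ^+ 3 = 343 / 512 by rewrite expr_div_n; congr (_ / _); ring.
rewrite E in A B.
by split; lra.
Qed.

(* For turning radius 1, a heading profile spends times [p * m] on [-m, 0] and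
   [q * m] on [0, m], then makes a right turn of angle [2 pi - 3 m] from 0.  The two
   equations say that its displacement is that of a straight segment of length
   [m * (p + q) - 3 * m] followed by a full turn; this is also the excess of its
   duration over that of a full turn. *)
Lemma loop_profile D : 0 < D -> exists m p q, [/\ 0 < m <= 1 / 2, 2 < p /\ 2 < q,
  (p + q) * (m - sin m) = 3 * m - sin (3 * m),
  (q - p) * (1 - cos m) = 1 - cos (3 * m) & 0 <= m * (p + q) - 3 * m <= D].
Proof.
move=> D0; pose m := Num.min (1 / 2) (D / 44).
have m0 : 0 < m by rewrite lt_min !divr_gt0.
have /andP[m1 mD] : (m <= 1 / 2) && (m <= D / 44) by rewrite -le_min.
clearbody m.
have [g1 g2] := sub_sin_bounds m0 m1.
have m3 : 0 < m ^+ 3 by exact: exprn_gt0.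
have g0 : 0 < m - sin m by lra.
(* By the triple-angle identity, the first equation says [p + q = r + 3], and the second holds with
   [q - p = (1 + 2 * cos m) ^+ 2], which is at most 9: [r > 10] is what yields [p > 2]. The excess
   is [m * r], at most [D] since [r <= 4 * 11]. *)
pose r := 4 * sin m ^+ 3 / (m - sin m).
have rg : r * (m - sin m) = 4 * sin m ^+ 3 by rewrite /r divfK// gt_eqF.
have r10 : 10 < r by rewrite /r ltr_pdivlMr.
have r44 : r <= 44.
  rewrite /r ler_pdivrMr//; have : sin m ^+ 3 <= m ^+ 3.
    have := sin_lower m0 m1 => ?.
    by rewrite lerXn2r ?nnegrE//; [lra|exact: ltW|lra].
  by lra.
clearbody r.
have c1 := cos_le1 m; have cN := cos_geN1 m.
have cc : (1 + 2 * cos m) ^+ 2 <= 9.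
  have : 0 <= (1 - cos m) * (2 + cos m) by apply: mulr_ge0; lra.
  by lra.
have cc0 := sqr_ge0 (1 + 2 * cos m).
exists m, ((r + 3 - (1 + 2 * cos m) ^+ 2) / 2), ((r + 3 + (1 + 2 * cos m) ^+ 2) / 2).
split.
- by rewrite m0.
- by split; lra.
- by rewrite sub_sin_triple -rg; field.
- by rewrite cos_triple; field.
- rewrite (_ : m * _ - 3 * m = m * r); last by field.
  apply/andP; split; first by rewrite mulr_ge0 ?ltW//; lra.
  have : m * r <= m * 44 by rewrite ler_pM2l.
  by lra.
Qed.

End LoopProfile.

Section Companions.
Context {R : realType} (rho : R) (rho_gt0 : 0 < rho).
Implicit Types (u w A : R -> R) (a c s t k x th phi T tau d : R) (bend : bool).

Local Notation heading := (heading rho).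
Local Notation advance := (advance rho).

(** The value [k = 0] is excluded because an extremal may run straight. *)
Definition bent u T := exists a c k, [/\ 0 <= a, a < c, c <= T, 0 < `|k| < 1
  & forall t, a <= t <= c -> heading u t = heading u a + k / rho * (t - a)].

(** [A] encodes the position by its coordinate in every direction. The flag asserts a bend only when
    true, so the same rules extend trajectories before and after their first bend. *)
Definition steers bend T th A := exists u, [/\ control u, heading u T = th,
  forall phi, advance u phi T = A phi & bend -> bent u T].

Lemma steers_arc bend T th A k tau : steers bend T th A -> 0 <= T -> 0 <= tau ->
  `|k| <= 1 -> exists u, [/\ control u,
    forall t, T <= t <= T + tau -> heading u t = th + k / rho * (t - T),
    forall phi, advance u phi (T + tau) =
      A phi + segint (fun t => cos (heading u t - phi)) T (T + tau)
    & bend -> bent u (T + tau)].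
Proof.
move=> [u [cu uT uA ub]] T0 tau0 k1.
have TT : T <= T + tau by rewrite lerDl.
have cp := control_overwrite T (T + tau) k1 cu.
exists (overwrite T (T + tau) k u); split=> //.
- by move=> t /andP[Tt tT]; rewrite heading_overwrite_in// uT.
- move=> phi; rewrite -uA /advance (segint_cat _ T0 TT); last exact: lbm_cos_heading.
  rewrite (@segint_eq _ _ (fun s => cos (heading u s - phi)) 0 T)//.
  by move=> x /andP[x0 xT]; rewrite heading_overwrite_before.
- move=> /ub[a [c [r [a0 ac cT r1 hE]]]]; exists a, c, r; split=> //.
    exact: (le_trans cT TT).
  move=> t /andP[at_ tc]; rewrite !heading_overwrite_before ?(le_trans a0)//.
  + by rewrite hE// at_.
  + exact: (le_trans (ltW ac) cT).
  + exact: (le_trans tc cT).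
Qed.

Lemma steers_turn bend bend' T th A k tau : steers bend T th A -> 0 <= T ->
  0 <= tau -> 0 < `|k| <= 1 -> (bend' -> bend || (`|k| < 1) && (0 < tau)) ->
  steers bend' (T + tau) (th + k / rho * tau) (fun phi => A phi +
    rho / k * (sin (th + k / rho * tau - phi) - sin (th - phi))).
Proof.
move=> st T0 tau0 /andP[k0 k1] bb.
have [u [cu uE uA ub]] := steers_arc st T0 tau0 k1.
have TT : T <= T + tau by rewrite lerDl.
have hT : heading u T = th by rewrite uE ?lexx// subrr mulr0 addr0.
have hTt : heading u (T + tau) = th + k / rho * tau.
  by rewrite uE ?lexx ?TT// addrAC subrr add0r.
exists u; split=> //.
- move=> phi; rewrite uA; congr (_ + _).
  rewrite (segint_cos_sweep _ TT _ uE); last first.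
    by apply: mulf_neq0; [rewrite -normr_gt0|rewrite invr_eq0 gt_eqF].
  by rewrite hTt hT invf_div mulrC.
- move=> /bb/orP[/ub//|/andP[klt taup]].
  exists T, (T + tau), k; split=> //.
  + by rewrite ltrDl.
  + by rewrite k0.
  + by move=> t tT; rewrite hT uE.
Qed.

Lemma steers_straight bend T th A tau : steers bend T th A -> 0 <= T -> 0 <= tau ->
  steers bend (T + tau) th (fun phi => A phi + tau * cos (th - phi)).
Proof.
move=> st T0 tau0; have [|u [cu uE uA ub]] := @steers_arc bend T th A 0 tau st T0 tau0.
  by rewrite normr0.
have TT : T <= T + tau by rewrite lerDl.
have hE t : T <= t <= T + tau -> heading u t = th by move=> /uE->; rewrite !mul0r addr0.
exists u; split=> //; first by rewrite hE// TT lexx.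
move=> phi; rewrite uA (@segint_eq _ _ (fun=> cos (th - phi))).
  by rewrite segint_cst// addrAC subrr add0r mulrC.
by move=> t /hE->.
Qed.

Lemma steers_ext bend T T' th A A' : steers bend T th A -> T = T' ->
  A =1 A' -> steers bend T' th A'.
Proof.
by move=> [u [cu uT uA ub]] <- AA; exists u; split=> // phi; rewrite uA AA.
Qed.

(* A turn through the headings from [th] to [th + sg * x] at half the maximal
   curvature spends the same time at each heading as a turn there and back at
   maximal curvature, hence has the same displacement and duration. *)
Lemma steers_half_curvature bend T th A sg x : steers bend T th A -> 0 <= T ->
  0 < x -> sg = 1 \/ sg = -1 ->
  steers true (T + 2 * rho * x) (th + sg * x) (fun phi => A phi +
    2 * rho * sg * (sin (th + sg * x - phi) - sin (th - phi))).
Proof.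
move=> st T0 x0 sg1.
have nsg : `|sg / 2| = 1 / 2.
  by case: sg1 => ->; rewrite ?mulN1r ?normrN ger0_norm// mul1r.
have tau0 : 0 < 2 * rho * x by rewrite !mulr_gt0.
have := @steers_turn bend true T th A (sg / 2) (2 * rho * x) st T0 (ltW tau0).
rewrite nsg => /(_ _ _)[].
- by apply/andP; split; lra.
- by move=> _; rewrite tau0 andbT; apply/orP; right; lra.
move=> u [cu uT uA ub]; exists u; split=> //.
- by rewrite uT; congr (_ + _); field; rewrite gt_eqF.
- move=> phi; rewrite uA; congr (_ + _).
  rewrite (_ : sg / 2 / rho * (2 * rho * x) = sg * x); last by field; rewrite gt_eqF.
  by congr (_ * _); case: sg1 => ->; field.
Qed.

(** The profile of [loop_profile], scaled by [rho]: the heading swings by [m] to either side of [th]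
    and back, at relative curvatures [2 / p] and [2 / q], below 1 because [p] and [q] exceed 2. The
    segment is cut by [d'], the excess of the profile over a full turn, which keeps the total
    duration. *)
Lemma steers_loop T th A d : steers false T th A -> 0 <= T -> 0 < d ->
  exists th', steers true (T + (d + rho * (pi *+ 2))) th'
    (fun phi => A phi + d * cos (th - phi)).
Proof.
move=> st T0 d0.
have [m [p [q [/andP[m0 m1] [p2 q2] eq1 eq2 /andP[D0 D1]]]]] :=
  loop_profile (divr_gt0 d0 rho_gt0).
have p0 : 0 < p by lra.
have q0 : 0 < q by lra.
pose d' := rho * (m * (p + q) - 3 * m).
have d'd : d' <= d by rewrite /d' mulrC -ler_pdivlMr.
have pi2 := @pi_ge2 R.
have sd : 0 <= d - d' by rewrite subr_ge0.
have s1 := steers_straight st T0 sd.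
have T1 : 0 <= T + (d - d') by rewrite addr_ge0.
have mp0 : 0 < rho * m * (p / 2) by rewrite !mulr_gt0// divr_gt0.
have mq0 : 0 < rho * m * (q / 2) by rewrite !mulr_gt0// divr_gt0.
have kp : 0 < `|2 / p| < 1.
  by rewrite ger0_norm ?divr_ge0// ?ltW// divr_gt0//= ltr_pdivrMr// mul1r.
have kq : 0 < `|2 / q| < 1.
  by rewrite ger0_norm ?divr_ge0// ?ltW// divr_gt0//= ltr_pdivrMr// mul1r.
have kpN : 0 < `|- (2 / p)| < 1 by rewrite normrN.
have kqN : 0 < `|- (2 / q)| < 1 by rewrite normrN.
have lt_le (k : R) : 0 < `|k| < 1 -> 0 < `|k| <= 1 by case/andP=> -> /ltW->.
have bent2 : (`|- (2 / p)| < 1) && (0 < rho * m * (p / 2)).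
  by rewrite mp0 andbT; case/andP: kpN.
have s2 := steers_turn (bend' := true) s1 T1 (ltW mp0) (lt_le _ kpN) (fun=> bent2).
have T2 := addr_ge0 T1 (ltW mp0).
have s3 := steers_turn (bend' := true) s2 T2 (ltW mp0) (lt_le _ kp) (fun=> isT).
have T3 := addr_ge0 T2 (ltW mp0).
have s4 := steers_turn (bend' := true) s3 T3 (ltW mq0) (lt_le _ kq) (fun=> isT).
have T4 := addr_ge0 T3 (ltW mq0).
have s5 := steers_turn (bend' := true) s4 T4 (ltW mq0) (lt_le _ kqN) (fun=> isT).
have T5 := addr_ge0 T4 (ltW mq0).
have l0 : 0 <= rho * (pi *+ 2 - 3 * m).
  by rewrite mulr_ge0 ?(ltW rho_gt0)// mulr2n; lra.
have k1 : 0 < `|-1 : R| <= 1 by rewrite normrN normr1 ltr01 lexx.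
have s6 := steers_turn (bend' := true) s5 T5 l0 k1 (fun=> isT).
have pN : p != 0 by rewrite gt_eqF.
have qN : q != 0 by rewrite gt_eqF.
have rN : rho != 0 by rewrite gt_eqF.
have e2 : - (2 / p) / rho * (rho * m * (p / 2)) = - m by field; rewrite pN rN.
have e3 : 2 / p / rho * (rho * m * (p / 2)) = m by field; rewrite pN rN.
have e4 : 2 / q / rho * (rho * m * (q / 2)) = m by field; rewrite qN rN.
have e5 : - (2 / q) / rho * (rho * m * (q / 2)) = - m by field; rewrite qN rN.
have e6 : -1 / rho * (rho * (pi *+ 2 - 3 * m)) = 3 * m - pi *+ 2 by field.
rewrite e2 e3 e4 e5 e6 in s6; eexists; apply: (steers_ext s6).
  by rewrite /d'; field.
move=> phi; rewrite /d'.
rewrite (_ : th - m + m = th); last by ring.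
rewrite (_ : th + m - m = th); last by ring.
rewrite [th + m - phi]addrAC [th - m - phi]addrAC.
have -> : sin (th + (3 * m - pi *+ 2) - phi) = sin (th - phi + 3 * m).
  by rewrite -sinD2pi; congr sin; ring.
move: (th - phi) => x; rewrite sinB !sinD.
rewrite (_ : sin (3 * m) = 3 * m - (p + q) * (m - sin m)); last by rewrite eq1; ring.
rewrite (_ : cos (3 * m) = 1 - (q - p) * (1 - cos m)); last by rewrite eq2; ring.
by field; rewrite pN qN.
Qed.

End Companions.

(** * Elimination of the other extremals *)

Section Conclusion.
Context {R : realType} (rho : R) (rho_gt0 : 0 < rho).
Implicit Types (u w : R -> R) (a b s t phi T sg : R).

Local Notation heading := (heading rho).
Local Notation advance := (advance rho).
Local Notation offset := (offset rho).
Local Notation turn := (turn rho).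

Lemma segint_rev (f : R -> R) a b : b < a -> segint f a b = 0.
Proof. by move=> ba; rewrite /segint set_itv_ge ?Rintegral_set0// bnd_simp -ltNge. Qed.

Lemma offset_sub u phi T s t : control u -> 0 <= s -> s <= t -> t <= T ->
  offset phi T u t - offset phi T u s = segint (fun x => sin (heading u x - phi)) s t.
Proof.
move=> cu s0 st tT; have lS := lbm_sin_heading rho_gt0 phi cu.
rewrite /offset (segint_cat lS st tT) (@segint_eq _ (fun x => sin (heading u x - phi))
  (fun x => -1 * sin (phi - heading u x))); last first.
  by move=> x _; rewrite mulN1r -sinN opprB.
by rewrite segintZ//; ring.
Qed.

(** Valid on the whole line because [offset] defaults to 0 beyond [T]. *)
Lemma offset_lipschitz u phi T s t : control u ->
  `|offset phi T u t - offset phi T u s| <= `|t - s|.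
Proof.
move=> cu; have lS := lbm_sin_heading rho_gt0 phi cu.
wlog st : s t / s <= t => [H|].
  have [/H//|/ltW/H] := leP s t.
  by rewrite distrC [X in _ <= X -> _]distrC.
have bound a b : a <= b -> `|segint (fun x => sin (phi - heading u x)) a b| <= b - a.
  move=> ab; rewrite -[leRHS]mul1r; apply: normr_segint_le => // x _.
  exact: sin_max.
rewrite [leRHS]ger0_norm ?subr_ge0// /offset.
have [tT|Tt] := leP t T.
  by rewrite (segint_cat lS st tT) opprD addrCA subrr addr0 normrN bound.
rewrite (segint_rev _ Tt) sub0r normrN.
have [sT|Ts] := leP s T; last by rewrite segint_rev// normr0 subr_ge0.
by apply: (le_trans (bound _ _ sT)); rewrite lerD2r ltW.
Qed.

Lemma extremal_patterns u phi T : 0 < T -> control u -> extremal rho phi T u ->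
  let psi t := heading u t - phi in
  [\/ exists c sg, [/\ 0 <= c <= T, turn psi sg 0 c
        & straight psi c T \/ exists sg', turn psi sg' c T],
      exists a b sg sg', [/\ 0 <= a < b, b < T, turn psi sg a b /\ turn psi sg' b T,
        T - b = b - a & sg' = sg -> b - a = rho * (pi *+ 2)],
      exists a b sg, [/\ 0 <= a < b, b < T, turn psi sg a b, straight psi b T
        & b - a = rho * (pi *+ 2)]
    | exists a b sg, [/\ 0 <= a < b, b < T, straight psi a b, turn psi sg b T
        & T - b = rho * (pi *+ 2)]].
Proof.
move=> T0 cu ext psi.
apply: (@switching_patterns _ rho T rho_gt0 psi (offset phi T u)) => //.
- move=> s t; rewrite /psi opprB addrA subrK; exact: heading_lipschitz.
- by move=> s t s0 st tT; exact: offset_sub.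
- by move=> s t; exact: offset_lipschitz.
- by rewrite /offset segintxx.
- move=> sg a b sg2 a0 ab bT near.
  by rewrite /psi (bang_bang rho_gt0 cu ext sg2 a0 ab bT near) addrAC.
Qed.

(** Where the offset is nonzero, [bang_bang] forces the full rate, so it vanishes along the bend.
    Then [sin psi] has two zeros close together, between which [psi] moves by a nonzero amount less
    than [pi]. *)
Lemma not_extremal_of_bent u phi T : control u -> bent rho u T ->
  extremal rho phi T u -> False.
Proof.
move=> cu [a [c [k [a0 ac cT /andP[k0 k1] hE]]]] ext.
have Y0 t : a < t <= c -> offset phi T u t = 0.
  move=> /andP[at_ tc]; apply/eqP; apply: contrapT => /negP Yt.
  pose sg := Num.sg (offset phi T u t).
  have sgY : sg * offset phi T u t = `|offset phi T u t| by rewrite -normrEsg.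
  have sg2 : sg ^+ 2 = 1 by rewrite sqr_sg Yt.
  have nsg : `|sg| = 1 by rewrite normr_sg Yt.
  have Yp : 0 < `|offset phi T u t| by rewrite normr_gt0.
  pose d := Num.min (t - a) (`|offset phi T u t| / 2).
  have d0 : 0 < d by rewrite lt_min subr_gt0 at_ divr_gt0.
  have /andP[da dY] : (d <= t - a) && (d <= `|offset phi T u t| / 2).
    by rewrite -le_min.
  clearbody d.
  have ad0 : 0 <= t - d by lra.
  have td : t - d <= t by lra.
  have near : t - (t - d) < sg * offset phi T u t by rewrite sgY; lra.
  have := bang_bang rho_gt0 cu ext sg2 ad0 td (le_trans tc cT) near.
  rewrite (hE t) ?(ltW at_)// (hE (t - d)); last by apply/andP; split; lra.
  move=> /eqP; rewrite -subr_eq0 (_ : _ - _ = (k - sg) * (d / rho)); last by field; rewrite gt_eqF.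
  rewrite mulf_eq0 subr_eq0 => /orP[/eqP ks|].
    by move: k1; rewrite ks nsg ltxx.
  by rewrite gt_eqF// divr_gt0.
pose psi t := heading u t - phi.
have psiL s t : `|psi t - psi s| <= `|t - s| / rho.
  by rewrite /psi opprB addrA subrK; exact: heading_lipschitz.
have rolle := @rolle_sin _ rho T rho_gt0 psi (offset phi T u) psiL
  (fun s t h1 h2 h3 => offset_sub phi cu h1 h2 h3).
(* The second and fourth quarters of [[a, a + e]] provide two distinct zeros, and [e <= rho] keeps
   the turn between them below 1. *)
pose e := Num.min (c - a) rho.
have e0 : 0 < e by rewrite lt_min subr_gt0 ac.
have /andP[ec er] : (e <= c - a) && (e <= rho) by rewrite -le_min.
clearbody e.
have z1 : 0 <= a + e / 4 by lra.
have z12 : a + e / 4 < a + e / 2 by lra.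
have z2 : a + e / 2 <= T by lra.
have z3 : 0 <= a + e * 3 / 4 by lra.
have z34 : a + e * 3 / 4 < a + e by lra.
have z4 : a + e <= T by lra.
have [|x /andP[x1 x2] sx] := rolle _ _ z1 z12 z2.
  by rewrite !Y0//; apply/andP; split; lra.
have [|y /andP[y1 y2] sy] := rolle _ _ z3 z34 z4.
  by rewrite !Y0//; apply/andP; split; lra.
have yx : psi y = psi x + k * ((y - x) / rho).
  rewrite /psi (hE y); last by apply/andP; split; lra.
  rewrite (hE x); last by apply/andP; split; lra.
  by field; rewrite gt_eqF.
move: sy; rewrite yx sinD sx mul0r add0r => /eqP; rewrite mulf_eq0.
have yxr : 0 < (y - x) / rho <= 1.
  by rewrite divr_gt0 ?subr_gt0 /=; [rewrite ler_pdivrMr// mul1r|..]; lra.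
case/orP=> [/eqP cx|].
  by have := cos2Dsin2 (psi x); rewrite cx sx expr0n addr0 => /eqP; rewrite eq_sym oner_eq0.
have kz : 0 < `|k * ((y - x) / rho)| < pi.
  case/andP: yxr => yx0 yx1; rewrite normrM (gtr0_norm yx0) mulr_gt0//=.
  apply: (@le_lt_trans _ _ (1 * 1)); first by rewrite ler_pM// ltW.
  by rewrite mulr1 (lt_le_trans _ (@pi_ge2 R))// ltr1n.
have := sin_gt0_pi kz; move=> sp /eqP s0; move: sp.
by case: ger0P; rewrite ?sinN s0 ?oppr0 ltxx.
Qed.

Lemma advance_turn u phi sg a b : control u -> 0 <= a -> a <= b ->
  turn (heading u) sg a b ->
  advance u phi b = advance u phi a +
    rho * sg * (sin (heading u b - phi) - sin (heading u a - phi)).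
Proof.
move=> cu a0 ab [sg1 hE].
have lc := lbm_cos_heading rho_gt0 phi cu.
have k0 : sg / rho != 0.
  apply: mulf_neq0; last by rewrite invr_eq0 gt_eqF.
  by case: sg1 => ->; rewrite ?oppr_eq0 oner_eq0.
have := segint_cat lc a0 ab; rewrite -/(advance u phi b) -/(advance u phi a) => ->.
rewrite (segint_cos_sweep phi ab k0 hE); congr (_ + _).
by case: sg1 => ->; field; rewrite gt_eqF.
Qed.

Lemma advance_straight u phi a b : control u -> 0 <= a -> a <= b ->
  straight (heading u) a b ->
  advance u phi b = advance u phi a + (b - a) * cos (heading u a - phi).
Proof.
move=> cu a0 ab hE; have lc := lbm_cos_heading rho_gt0 phi cu.
have := segint_cat lc a0 ab; rewrite -/(advance u phi b) -/(advance u phi a) => ->.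
rewrite (@segint_eq _ _ (fun=> cos (heading u a - phi)) a b); last by move=> t /hE->.
by rewrite segint_cst// mulrC.
Qed.

Lemma turn_shift u phi sg a b :
  turn (fun t => heading u t - phi) sg a b -> turn (heading u) sg a b.
Proof.
move=> [sg1 hE]; split=> // t tab; have := hE t tab => /eqP.
by rewrite subr_eq => /eqP->; ring.
Qed.

Lemma straight_shift u phi a b :
  straight (fun t => heading u t - phi) a b -> straight (heading u) a b.
Proof. by move=> hE t tab; have /addIr := hE t tab. Qed.

Lemma turn_end u sg a b : a <= b -> turn (heading u) sg a b ->
  heading u b = heading u a + sg / rho * (b - a).
Proof. by move=> ab [_]; apply; rewrite ab lexx. Qed.

Lemma turn_circle u sg a b : a <= b -> turn (heading u) sg a b ->
  b - a = rho * (pi *+ 2) -> forall x, sin (heading u b - x) = sin (heading u a - x)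
    /\ cos (heading u b - x) = cos (heading u a - x).
Proof.
move=> ab tab E x; rewrite (turn_end ab tab) E.
have -> : sg / rho * (rho * (pi *+ 2)) = sg * (pi *+ 2) by field; rewrite gt_eqF.
case: tab => -[] -> _; rewrite ?mul1r ?mulN1r.
  by rewrite addrAC sinD2pi cosD2pi.
have -> : heading u a - x = heading u a - pi *+ 2 - x + pi *+ 2 by ring.
by rewrite sinD2pi cosD2pi.
Qed.

(* Each of the last three patterns of [switching_patterns] has the end point and
   the duration of some bent trajectory, which is not extremal. *)
Lemma minimal_pattern u T : 0 < T -> control u ->
  (forall w, control w -> (forall phi, advance w phi T = advance u phi T) ->
     exists phi, extremal rho phi T w) ->
  exists c sg, [/\ 0 <= c <= T, turn (heading u) sg 0 c
    & straight (heading u) c T \/ exists sg', turn (heading u) sg' c T].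
Proof.
move=> T0 cu opt.
have no_bent th A : steers rho true T th A -> (forall phi, A phi = advance u phi T) -> False.
  move=> [w [cw _ wA wb]] AE; have [|phi ext] := opt w cw.
    by move=> phi; rewrite wA AE.
  exact: (not_extremal_of_bent cw (wb isT) ext).
have start a : steers rho false a (heading u a) (fun phi => advance u phi a) by exists u.
have [phi ext] := opt u cu (fun=> erefl).
have [] := extremal_patterns T0 cu ext.
- move=> [c [sg [cT /turn_shift tc st]]]; exists c, sg; split=> //.
  case: st => [/straight_shift ?|[sg' /turn_shift ?]]; first by left.
  by right; exists sg'.
- move=> [a [b [sg [sg' [/andP[a0 ab] bT [/turn_shift tab /turn_shift tbT] E circ]]]]].
  exfalso; have sg1 := tab.1; have sg1' := tbT.1.
  have x0 : 0 < (b - a) / rho by rewrite divr_gt0// subr_gt0.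
  have b0 : 0 <= b by exact: (le_trans a0 (ltW ab)).
  (* Opposite turns retrace the same headings; equal ones are two full circles, replaced by one of
     radius [2 * rho]. *)
  have s := steers_half_curvature rho_gt0 (start a) a0 x0 sg1.
  have TE : a + 2 * rho * ((b - a) / rho) = T.
    rewrite (_ : 2 * rho * ((b - a) / rho) = (b - a) + (b - a)); last first.
      by field; rewrite gt_eqF.
    by rewrite -{2}E; ring.
  rewrite TE in s; apply: (no_bent _ _ s) => p.
  rewrite (advance_turn p cu b0 (ltW bT) tbT) (advance_turn p cu a0 (ltW ab) tab).
  have hb : heading u a + sg * ((b - a) / rho) = heading u b.
    by rewrite (turn_end (ltW ab) tab); congr (_ + _); field; rewrite gt_eqF.
  rewrite hb.
  have [ss|ss] : sg' = sg \/ sg' = - sg.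
  + by case: sg1 => ->; case: sg1' => ->; rewrite ?opprK; [left|right|right|left].
  + have [-> _] := turn_circle (ltW ab) tab (circ ss) p.
    have [|-> _] := turn_circle (ltW bT) tbT _ p; first by rewrite E circ.
    have [-> _] := turn_circle (ltW ab) tab (circ ss) p.
    by ring.
  + have -> : heading u T = heading u a.
      rewrite (turn_end (ltW bT) tbT) (turn_end (ltW ab) tab) E ss.
      by field; rewrite gt_eqF.
    by rewrite ss; ring.
- move=> [a [b [sg [/andP[a0 ab] bT /turn_shift tab /straight_shift sbT E]]]].
  exfalso; have d0 : 0 < T - b by rewrite subr_gt0.
  have b0 : 0 <= b by exact: (le_trans a0 (ltW ab)).
  (* A full circle restores position and heading, so it may be exchanged with the segment: the
     companion runs the segment first. *)
  have [th s] := steers_loop rho_gt0 (start a) a0 d0.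
  rewrite -E (_ : a + (T - b + (b - a)) = T) in s; last by ring.
  apply: (no_bent _ _ s) => p.
  rewrite (advance_straight p cu b0 (ltW bT) sbT) (advance_turn p cu a0 (ltW ab) tab).
  by have [-> ->] := turn_circle (ltW ab) tab E p; ring.
move=> [a [b [sg [/andP[a0 ab] bT /straight_shift sab /turn_shift tbT E]]]].
exfalso; have d0 : 0 < b - a by rewrite subr_gt0.
have b0 : 0 <= b by exact: (le_trans a0 (ltW ab)).
have [th s] := steers_loop rho_gt0 (start a) a0 d0.
rewrite -E (_ : a + (b - a + (T - b)) = T) in s; last by ring.
apply: (no_bent _ _ s) => p.
rewrite (advance_turn p cu b0 (ltW bT) tbT) (advance_straight p cu a0 (ltW ab) sab).
by have [-> _] := turn_circle (ltW bT) tbT E p; ring.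
Qed.

End Conclusion.

(** * From switching patterns to path types *)

Section Pieces.
Context {R : realType} (rho : R) (rho_gt0 : 0 < rho).
Context (u : R -> R) (cu : control u) (gamma : R -> R * R) (T : R).
Context (gammaE : forall t, 0 <= t <= T ->
  gamma t = (advance rho u 0 t, advance rho u (pi / 2) t)).

Local Notation heading := (heading rho).
Local Notation turn := (turn rho).

Lemma is_piece_refl k b : k <> SegS -> is_piece rho gamma b b k.
Proof.
case: k => // _; exists 0, ((gamma b).1 - rho, (gamma b).2), 0;
  split; rewrite ?mulr0 ?addr0// => t /le_anti <-;
  rewrite subrr mul0r ?subr0 ?addr0 cos0 sin0 mulr0 addr0 mulr1 /= subrK;
  exact: surjective_pairing.
Qed.

Lemma turn_sub sg a b t : turn (heading u) sg a b -> t <= b -> turn (heading u) sg a t.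
Proof.
by move=> [sg1 hE] tb; split=> // x /andP[ax xt]; apply: hE; rewrite ax (le_trans xt).
Qed.

Lemma position_turn sg a b t : 0 <= a -> b <= T -> turn (heading u) sg a b ->
  a <= t <= b ->
  gamma t = ((gamma a).1 + rho * sg *
               (sin (heading u a + sg * ((t - a) / rho)) - sin (heading u a)),
             (gamma a).2 - rho * sg *
               (cos (heading u a + sg * ((t - a) / rho)) - cos (heading u a))).
Proof.
move=> a0 bT tab /andP[at_ tb]; have tat := turn_sub tab tb.
rewrite !gammaE /=; last 2 first.
- by rewrite a0 (le_trans at_ (le_trans tb bT)).
- by rewrite (le_trans a0 at_) (le_trans tb bT).
rewrite !(advance_turn rho_gt0 _ cu a0 at_ tat) (turn_end at_ tat).
rewrite !subr0 !sinBpihalf (_ : sg / rho * (t - a) = sg * ((t - a) / rho)); last by ring.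
by congr (_, _); ring.
Qed.

(** The center lies at distance [rho] to the left of the heading, so the initial polar angle is the
    heading minus a quarter turn. *)
Lemma is_piece_left a b : 0 <= a -> a <= b -> b <= T -> turn (heading u) 1 a b ->
  is_piece rho gamma a b ArcL.
Proof.
move=> a0 ab bT tab; exists ((b - a) / rho),
  ((gamma a).1 - rho * sin (heading u a), (gamma a).2 + rho * cos (heading u a)),
  (heading u a - pi / 2).
split; first by rewrite divr_ge0 ?subr_ge0// ltW.
  by rewrite mulrC divfK ?gt_eqF// addrC subrK.
move=> t tab'; rewrite (position_turn a0 bT tab tab') mulr1 mul1r.
rewrite [heading u a - _ + _]addrAC cosBpihalf sinBpihalf.
by congr (_, _) => /=; ring.
Qed.

Lemma is_piece_right a b : 0 <= a -> a <= b -> b <= T -> turn (heading u) (-1) a b ->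
  is_piece rho gamma a b ArcR.
Proof.
move=> a0 ab bT tab; exists ((b - a) / rho),
  ((gamma a).1 + rho * sin (heading u a), (gamma a).2 - rho * cos (heading u a)),
  (heading u a + pi / 2).
split; first by rewrite divr_ge0 ?subr_ge0// ltW.
  by rewrite mulrC divfK ?gt_eqF// addrC subrK.
move=> t tab'; rewrite (position_turn a0 bT tab tab') mulrN1 mulN1r.
rewrite [heading u a + _ - _]addrAC cosDpihalf sinDpihalf.
by congr (_, _) => /=; ring.
Qed.

Lemma is_piece_straight a b : 0 <= a -> a <= b -> b <= T -> straight (heading u) a b ->
  is_piece rho gamma a b SegS.
Proof.
move=> a0 ab bT sab; exists (b - a), (heading u a).
split; first by rewrite subr_ge0.
  by rewrite addrC subrK.
move=> t /andP[at_ tb].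
have sat : straight (heading u) a t.
  by move=> x /andP[ax xt]; apply: sab; rewrite ax (le_trans xt).
rewrite !gammaE /=; last 2 first.
- by rewrite a0 (le_trans at_ (le_trans tb bT)).
- by rewrite (le_trans a0 at_) (le_trans tb bT).
by rewrite !(advance_straight rho_gt0 _ cu a0 at_ sat) subr0 cosBpihalf.
Qed.

(** Two turns in the same direction merge into one arc, and an arc of zero length completes the
    word. *)
Lemma has_type_of_pattern c sg : 0 <= c <= T -> turn (heading u) sg 0 c ->
  straight (heading u) c T \/ (exists sg', turn (heading u) sg' c T) ->
  [\/ has_type rho gamma 0 T [:: ArcR; ArcL],
      has_type rho gamma 0 T [:: ArcL; ArcR],
      has_type rho gamma 0 T [:: ArcL; SegS]
    | has_type rho gamma 0 T [:: ArcR; SegS]].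
Proof.
move=> /andP[c0 cT] tc.
have two k1 k2 d : is_piece rho gamma 0 d k1 -> is_piece rho gamma d T k2 ->
    has_type rho gamma 0 T [:: k1; k2].
  by move=> p1 p2; exists d; split=> //; exists T.
have T0 := le_trans c0 cT.
have merge s : turn (heading u) s 0 c -> turn (heading u) s c T -> turn (heading u) s 0 T.
  move=> t1 t2; split; first exact: t1.1.
  move=> t /andP[t0 tT]; have [tlc|/ltW clt] := leP t c.
    by apply: t1.2; rewrite t0.
  by rewrite t2.2 ?clt// (turn_end c0 t1); ring.
case=> [sc|[sg' tc']].
  have ps := is_piece_straight c0 cT (lexx _) sc.
  case: tc.1 => sgE; rewrite sgE in tc.
    by apply: Or43; apply: (two _ _ c) => //; exact: is_piece_left.
  by apply: Or44; apply: (two _ _ c) => //; exact: is_piece_right.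
case: tc.1 => sgE; case: tc'.1 => sgE'; rewrite sgE in tc; rewrite sgE' in tc'.
- apply: Or42; apply: (two _ _ T); last exact: is_piece_refl.
  by apply: is_piece_left => //; exact: merge.
- by apply: Or42; apply: (two _ _ c); [exact: is_piece_left|exact: is_piece_right].
- by apply: Or41; apply: (two _ _ c); [exact: is_piece_right|exact: is_piece_left].
- apply: Or41; apply: (two _ _ T); last exact: is_piece_refl.
  by apply: is_piece_right => //; exact: merge.
Qed.

End Pieces.

(** * Trajectories of the problem and controls on the whole line *)

Section Bridge.
Context {R : realType} (rho : R) (rho_gt0 : 0 < rho).

Lemma trajectory_of_control T (w : R -> R) : control w ->
  dubins_trajectory rho T w
    (fun t => (advance rho w 0 t, advance rho w (pi / 2) t)) (heading rho w).
Proof.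
move=> cw t _; split=> //=; apply: segint_eq => x _; first by rewrite subr0.
by rewrite cosBpihalf.
Qed.

(** The control is extended by 0 outside [[0, T]]; positions up to [T] depend only on its values
    there. *)
Lemma control_of_trajectory T u gamma theta : admissible_control T u ->
  dubins_trajectory rho T u gamma theta ->
  exists2 w, control w & forall t, 0 <= t <= T ->
    gamma t = (advance rho w 0 t, advance rho w (pi / 2) t).
Proof.
move=> [mu u1] traj; pose w := u \_ `[0, T].
have wE t : 0 <= t <= T -> w t = u t.
  by move=> tT; rewrite /w patchE mem_set//= in_itv.
have cw : control w.
  split; first exact: ((measurable_restrictT _ (measurable_itv _)).1 mu).
  move=> t; have [tT|tT] := boolP (0 <= t <= T).
    by rewrite wE// ler_norml; exact: u1.
  rewrite /w patchE memNset ?normr0//= in_itv/=; exact/negP.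
have hE t : 0 <= t <= T -> theta t = heading rho w t.
  move=> tT; have [-> _ _] := traj t tT; congr (_ + _).
  apply: segint_eq => x /andP[x0 xt]; rewrite wE// x0 (le_trans xt)//.
  by case/andP: tT.
exists w => // t tT; have [_ g1 g2] := traj t tT.
rewrite [LHS]surjective_pairing g1 g2; case/andP: (tT) => t0 t1.
congr (_, _); apply: segint_eq => x /andP[x0 xt].
  by rewrite hE ?subr0// x0 (le_trans xt).
by rewrite hE ?cosBpihalf// x0 (le_trans xt).
Qed.

Lemma segint_lipschitz (f : R -> R) :
  measurable_fun (`[0, +oo[ : set R) f -> (forall t, 0 <= t -> `|f t| <= 1) ->
  forall s t, 0 <= s -> s <= t -> `|segint f 0 t - segint f 0 s| <= t - s.
Proof.
move=> mf f1 s t s0 st; pose g := f \_ `[0, +oo[.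
have gE x : 0 <= x -> g x = f x.
  by move=> x0; rewrite /g patchE mem_set//= in_itv/= x0.
have lg : locally_bounded_measurable g.
  apply: (@lbm_bounded _ _ 1); first exact: ((measurable_restrictT _ (measurable_itv _)).1 mf).
  move=> x; have [x0|x0] := leP 0 x; first by rewrite gE// f1.
  by rewrite /g patchE memNset ?normr0//= in_itv/= andbT; apply/negP; rewrite -ltNge.
have fg b : segint f 0 b = segint g 0 b.
  by apply: segint_eq => x /andP[x0 _]; rewrite gE.
rewrite !fg (segint_cat lg s0 st) addrC addKr -[leRHS]mul1r.
by apply: normr_segint_le => // x /andP[sx _]; rewrite gE ?f1// (le_trans s0).
Qed.

End Bridge.

Theorem mainTheorem3 (R : realType) (rho : R) (p0 : R * R) (v : R -> R * R)
    (rho_gt0 : 0 < rho)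
    (mv1 : measurable_fun (`[0, +oo[ : set R) (fun t => (v t).1))
    (mv2 : measurable_fun (`[0, +oo[ : set R) (fun t => (v t).2))
    (v_lt1 : forall t, 0 <= t -> euclidean_norm (v t) < 1)
    (tm : R) (gamma : R -> R * R) :
  mtip_solution rho p0 v tm gamma ->
  [\/ has_type rho gamma 0 tm [:: ArcR; ArcL],
      has_type rho gamma 0 tm [:: ArcL; ArcR],
      has_type rho gamma 0 tm [:: ArcL; SegS]
    | has_type rho gamma 0 tm [:: ArcR; SegS]].
Proof.
move=> [tm0 [[u0 [theta [au traj]]] hit] minimal].
have [u cu gammaE] := control_of_trajectory au traj.
have v1 t : 0 <= t -> `|(v t).1| <= 1.
  by move=> /v_lt1/ltW; apply: le_trans; exact: (norm_le_sqrt_sum _ _).1.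
have v2 t : 0 <= t -> `|(v t).2| <= 1.
  by move=> /v_lt1/ltW; apply: le_trans; exact: (norm_le_sqrt_sum _ _).2.
have [|c [sg [cT tc st]]] := minimal_pattern rho_gt0 tm0 cu; last first.
  exact: (has_type_of_pattern rho_gt0 cu gammaE cT tc st).
(* Any [w] with the same end point also intercepts at the minimal time, hence is extremal for some
   direction of its own; this is what a bent companion contradicts. *)
move=> w cw wu.
have tmtm : 0 <= tm <= tm by rewrite lexx ltW.
apply: (@extremal_of_minimal _ rho rho_gt0 w tm (target_position p0 v)) => //.
- by rewrite wu -hit gammaE.
- by rewrite wu -hit gammaE.
- move=> s t s0 st; rewrite /target_position /=.
  have E (a b c : R) : a + b - (a + c) = b - c by ring.
  rewrite 2!E.
  by split; [exact: (segint_lipschitz mv1 v1)|exact: (segint_lipschitz mv2 v2)].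
- move=> s w' s0 stm cw' e1 e2.
  have : tm <= s.
    apply: (minimal s (fun t => (advance rho w' 0 t, advance rho w' (pi / 2) t))) => //.
    split; last by rewrite e1 e2 -surjective_pairing.
    exists w', (heading rho w'); split; last exact: trajectory_of_control.
    split; first by apply: measurable_funTS; exact: cw'.1.
    by move=> t _; rewrite -ler_norml; exact: cw'.2.
  by rewrite leNgt stm.
Qed.
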